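(* Let $\Gamma$ be a non-elementary hyperbolic group. For any pair $d,d_*\in\mathcal{D}_\Gamma$ such that $[d]\ne[d_*]$ in $\mathscr{D}_\Gamma$, there exists a continuous, injective map $\rho_\bullet:\mathbb{R}\to\mathscr{D}_\Gamma$ satisfying: (i) $\rho_0=[d]$ and $\rho_{h(d_* )}=[d_*]$, where $h(d_* )$ is the exponential growth rate of $d_*$; (ii) $\Delta(\rho_r,\rho_t)=\Delta(\rho_r,\rho_s)+\Delta(\rho_s,\rho_t)$ for all $r<s<t$; and (iii) $\lim_{t\to\infty}\Delta(\rho_t,\rho_{h(d_* )})=\lim_{t\to-\infty}\Delta(\rho_t,\rho_0)=\infty$.
   Context: $\Gamma$ is a non-elementary (i.e. not virtually cyclic) Gromov hyperbolic group with identity element $o$. A pseudo metric $d$ on $\Gamma$ is a symmetric function $d:\Gamma\times\Gamma\to[0,\infty)$ satisfying the triangle inequality and $d(x,x)=0$. Its Gromov product is $(x|y)_{z,d}=\frac12(d(x,z)+d(z,y)-d(x,y))$. It is hyperbolic if there is $\delta\ge0$ with $(x|y)_{z,d}\ge\min\{(x|w)_{z,d},(w|y)_{z,d}\}-\delta$ for all $x,y,z,w\in\Gamma$. Two pseudo metrics on $\Gamma$ are quasi-isometric if the identity map of $\Gamma$ is a quasi-isometry between them. $\mathcal{D}_\Gamma$ is the set of all left-invariant hyperbolic pseudo metrics on $\Gamma$ that are quasi-isometric to a word metric (for a finite symmetric generating set). The exponential growth rate of $d\in\mathcal{D}_\Gamma$ is $h(d)=\limsup_{n\to\infty}\frac1n\log\#\{x\in\Gamma: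 d(o,x)<n\}$. For $d\in\mathcal{D}_\Gamma$, $\ell_d[x]=\lim_{n\to\infty}\frac1n d(o,x^n)$ is the stable translation length, and $\mathbf{conj}'$ is the set of conjugacy classes of non-torsion elements of $\Gamma$. The dilation is $\mathrm{Dil}(d,d_* )=\sup_{[x]\in\mathbf{conj}'}\frac{\ell_d[x]}{\ell_{d_*}[x]}$. Two pseudo metrics $d,d_*$ on $\Gamma$ are roughly similar if there are $\tau,C>0$ with $|\tau d(x,y)-d_*(x,y)|\le C$ for all $x,y\in\Gamma$. $\mathscr{D}_\Gamma$ is the quotient of $\mathcal{D}_\Gamma$ by rough similarity, with $[d]$ denoting the class of $d$; it is equipped with the metric $\Delta([d],[d_*])=\log(\mathrm{Dil}(d,d_* )\,\mathrm{Dil}(d_*,d))$ and the induced topology. *)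

(* Defs.v *)
From HB Require Import structures.
From mathcomp Require Import all_boot all_order all_algebra.
From mathcomp Require Import finmap.
From mathcomp Require Import all_classical all_reals all_analysis.

Set Implicit Arguments.
Unset Strict Implicit.
Unset Printing Implicit Defensive.

Import Order.TTheory GRing.Theory Num.Theory.
Import numFieldNormedType.Exports.

Local Open Scope classical_set_scope.
Local Open Scope quotient_scope.
Local Open Scope ring_scope.

Section Metrics.
Variables (R : realType) (G : groupType).
Implicit Types (d : G -> G -> R) (S : set G) (x y z w g : G).

Definition pseudo_metric d : Prop :=
  [/\ forall x y, 0 <= d x y,
      forall x, d x x = 0,
      forall x y, d x y = d y x &
      forall x y z, d x z <= d x y + d y z].

Definition left_invariant d : Prop :=
  forall g x y, d (g * x)%g (g * y)%g = d x y.

Definition gromov_product d z x y : R := (d x z + d z y - d x y) / 2.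

Definition gromov_hyperbolic d : Prop :=
  exists2 delta : R, 0 <= delta & forall x y z w,
    Num.min (gromov_product d z x w) (gromov_product d z w y) - delta
      <= gromov_product d z x y.

Definition quasi_isometry d d' (f : G -> G) : Prop :=
  exists L C : R, [/\ 1 <= L, 0 <= C,
    forall x y, L^-1 * d x y - C <= d' (f x) (f y) <= L * d x y + C &
    forall y, exists x, d' (f x) y <= C].

Definition quasi_isometric d d' : Prop := quasi_isometry d d' id.

Definition word_of S x : set (seq G) :=
  [set s | (forall g, g \in s -> S g) /\ (\prod_(g <- s) g)%g = x].

Definition finite_symmetric_generating S : Prop :=
  [/\ finite_set S, forall g, S g -> S g^-1%g & forall x, word_of S x !=set0].

(* The infimum is attained when S generates G (word_metric_attained below). *)
Definition word_metric S x y : R :=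
  inf [set (size s)%:R | s in word_of S (x^-1 * y)%g].

(* Four-point condition on the vertices of a Cayley graph; it holds for one
   finite generating set if and only if it holds for all of them. *)
Definition hyperbolic_group : Prop :=
  exists2 S, finite_symmetric_generating S & gromov_hyperbolic (word_metric S).

Definition cyclic_subgroup g : set G :=
  [set x | exists n, x = (g ^+ n)%g \/ x = (g ^- n)%g].

Definition finite_index (H : set G) : Prop :=
  finite_set (range (fun x => [set (x * h)%g | h in H])).

(* Finite groups are included (g = 1). *)
Definition virtually_cyclic : Prop := exists g, finite_index (cyclic_subgroup g).

Definition non_torsion : set G := [set x | forall n, (x ^+ n.+1)%g <> 1%g].

Definition conj_class x : set G := range (fun g => (x ^ g)%g).

Definition conj' : set (set G) := conj_class @` non_torsion.

Definition roughly_similar d d' : Prop :=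
  exists tau C : R, [/\ 0 < tau, 0 < C & forall x y, `|tau * d x y - d' x y| <= C].

Record hypMetric := HypMetric {
  hdist :> G -> G -> R;
  hdist_pseudo_metric : pseudo_metric hdist;
  hdist_left_invariant : left_invariant hdist;
  hdist_hyperbolic : gromov_hyperbolic hdist;
  hdist_word : exists2 S, finite_symmetric_generating S &
                          quasi_isometric hdist (word_metric S) }.

(* The balls are finite for d : hypMetric (hyp_ball_finite below), so that
   fset_set does not take its default value. *)
Definition growth_rate d : R :=
  fine (limn_esup (fun n : nat =>
    (ln (#|` fset_set [set x | d 1%g x < n%:R]|%:R : R) / n%:R)%:E)).

Definition stable_length d x : R := limn (fun n : nat => d 1%g (x ^+ n)%g / n%:R).

(* Independent of the chosen element of c, see stable_length_classE below. *)
Definition stable_length_class d (c : set G) : R := stable_length d (xget 1%g c).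

(* For d, d' : hypMetric the set is bounded (ratios_ub below); the convention
   r / 0 = 0 plays no role in a hyperbolic group, where the stable lengths of
   non-torsion elements are positive. *)
Definition Dil d d' : R :=
  sup [set stable_length_class d c / stable_length_class d' c | c in conj'].

End Metrics.

HB.instance Definition _ (R : realType) (G : groupType) :=
  gen_eqMixin (hypMetric R G).
HB.instance Definition _ (R : realType) (G : groupType) :=
  gen_choiceMixin (hypMetric R G).

Section WordMetric.
Variables (R : realType) (G : groupType).
Implicit Types (S : set G) (x y : G).

Lemma word_metric_attained S x y : finite_symmetric_generating S ->
  exists2 s, word_of S (x^-1 * y)%g s & word_metric R S x y = (size s)%:R.
Proof.
move=> [_ _ gS]; have [s0 ws0] := gS (x^-1 * y)%g.
pose P n := `[< exists2 s, word_of S (x^-1 * y)%g s & size s = n >].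
have exP : exists n, P n by exists (size s0); apply/asboolP; exists s0.
case: (ex_minnP exP) => m /asboolP[s ws <-] mP; exists s => //.
apply/eqP; rewrite eq_le; apply/andP; split.
  apply: ge_inf; last by exists s.
  by exists 0 => _ [t _ <-]; rewrite ler0n.
apply: lb_le_inf; first by exists (size s)%:R, s.
move=> _ [t wt <-]; rewrite ler_nat; apply: mP.
by apply/asboolP; exists t.
Qed.

Lemma word_ball_finite S n : finite_set S ->
  finite_set [set x | exists2 s, word_of S x s & (size s <= n)%N].
Proof.
move=> fS; elim: n => [|n IHn].
  apply: (sub_finite_set _ (finite_set1 1%g)) => x [[|//] [_ <-] _].
  by rewrite big_nil.
apply: (@sub_finite_set _ _ ([set 1%g] `|`
  [set (a * b)%g | a in S & b in
    [set x | exists2 s, word_of S x s & (size s <= n)%N]])); last first.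
  rewrite finite_setU; split; [exact: finite_set1 | exact: finite_image2].
move=> x [[|g s] [sS <-]]; first by left; rewrite /= big_nil.
rewrite /= ltnS => sn; right; exists g; first by apply: sS; rewrite mem_head.
exists (\prod_(h <- s) h)%g; last by rewrite big_cons.
by exists s => //; split=> // h hs; apply: sS; rewrite in_cons hs orbT.
Qed.

Lemma hyp_ball_finite (d : hypMetric R G) (r : R) :
  finite_set [set x | d 1%g x < r].
Proof.
have [S gS [L [C [L1 C0 qi _]]]] := hdist_word d.
have [fS _ _] := gS.
apply: (sub_finite_set _ (@word_ball_finite S (Num.truncn (L * r + C)).+1 fS)).
move=> x /= dx; have [s ws ls] := @word_metric_attained S 1%g x gS.
exists s; first by move: ws; rewrite invg1 mul1g.
rewrite ltnW // -(ltr_nat R); apply: le_lt_trans (truncnS_gt _).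
have /andP[_] := qi 1%g x; rewrite ls => /le_trans; apply.
by rewrite lerD2r ler_wpM2l ?(ltW dx)// (le_trans _ L1).
Qed.

Lemma hyp_le_affine (d d' : hypMetric R G) :
  exists2 K : R, 0 <= K & exists C : R, forall x y, d x y <= K * d' x y + C.
Proof.
have [S gS [L [C [L1 C0 qi _]]]] := hdist_word d'.
have [fS _ _] := gS; have [d0 dxx dC dT] := hdist_pseudo_metric d.
have [M M0 SM] : exists2 M : R, 0 <= M & forall g, S g -> d 1%g g <= M.
  case/finite_seqP: fS => l ->.
  exists (\sum_(g <- l) d 1%g g); first by apply: sumr_ge0.
  move=> g /= gl; rewrite (big_rem g) //= lerDl; exact: sumr_ge0.
have dw s x y : word_of S (x^-1 * y)%g s -> d x y <= M * (size s)%:R.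
  elim: s x y => [|g s IHs] x y [sS].
    rewrite big_nil => e; have -> : y = x.
      by rewrite -[y](mulVKg x) -e mulg1.
    by rewrite dxx mulr0.
  rewrite big_cons /= => e.
  have ws : word_of S ((x * g)^-1 * y)%g s.
    split; first by move=> h hs; apply: sS; rewrite in_cons hs orbT.
    by rewrite invgM -mulgA -e mulKg.
  apply: le_trans (dT _ (x * g)%g _) _.
  rewrite -natr1 mulrDr mulr1 addrC lerD ?IHs//.
  rewrite -[X in d X _](mulg1 x) hdist_left_invariant SM//.
  by apply: sS; rewrite mem_head.
exists (M * L); first by rewrite mulr_ge0// (le_trans _ L1).
exists (M * C) => x y; have [s ws ls] := @word_metric_attained S x y gS.
apply: le_trans (dw _ _ _ ws) _; rewrite -mulrA -mulrDr ler_wpM2l// -ls.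
by have /andP[] := qi x y.
Qed.

End WordMetric.

Section StableLength.
Variables (R : realType) (G : groupType).
Implicit Types (d e f : hypMetric R G) (x y g : G).

Let len d x : R^nat := fun n => d 1%g (x ^+ n)%g / n%:R.

Lemma hyp_subadditive d x m n :
  d 1%g (x ^+ (m + n))%g <= d 1%g (x ^+ m)%g + d 1%g (x ^+ n)%g.
Proof.
have [_ _ _ dT] := hdist_pseudo_metric d.
apply: le_trans (dT _ (x ^+ m)%g _) _; rewrite lerD2l expgnDr.
by rewrite -[X in d X _](mulg1 (x ^+ m)%g) hdist_left_invariant.
Qed.

Lemma stable_length_cvg d x : len d x @ \oo --> stable_length d x.
Proof.
suff : cvgn (len d x) by [].
have [d0 dxx _ _] := hdist_pseudo_metric d.
pose a n := d 1%g (x ^+ n)%g; pose l := inf [set a n.+1 / n.+1%:R | n in setT].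
have a0 n : 0 <= a n by exact: d0.
have aM k m : a (k * m)%N <= k%:R * a m.
  elim: k => [|k IH]; first by rewrite mul0n mul0r /a expg0 dxx.
  rewrite mulSn (le_trans (hyp_subadditive _ _ _ _))//.
  by rewrite -natr1 mulrDl mul1r addrC lerD2r.
have lb : has_lbound [set a n.+1 / n.+1%:R | n in setT].
  by exists 0 => _ [n _ <-]; rewrite divr_ge0.
apply/cvg_ex; exists l; apply/cvgrPdist_le => eps eps0.
have [_ [m _ <-] am] : exists2 v, [set a n.+1 / n.+1%:R | n in setT] v &
    v < l + eps / 2.
  apply: inf_adherent; first by rewrite divr_gt0.
  by split=> //; exists (a 1%N / 1%:R), 0%N.
pose B := \sum_(i < m.+1) a i.
have aB i : (i < m.+1)%N -> a i <= B.
  move=> im; rewrite /B (bigD1 (Ordinal im)) //= lerDl; exact: sumr_ge0.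
near=> n.
have n0 : (0 < n)%N by near: n; exists 1%N.
have nR0 : 0 < n%:R :> R by rewrite ltr0n.
have ln : l <= len d x n.
  by apply: ge_inf => //; exists n.-1 => //; rewrite prednK.
rewrite distrC ger0_norm ?subr_ge0// lerBlDl.
suff : len d x n <= a m.+1 / m.+1%:R + B / n%:R.
  move/le_trans; apply; rewrite [in leRHS](splitr eps) addrA lerD ?(ltW am)//.
  rewrite ler_pdivrMr// -ler_pdivrMl ?divr_gt0//.
  near: n; exact: nbhs_infty_ger.
rewrite ler_pdivrMr// mulrDl divfK ?gt_eqF//.
rewrite [in leLHS](divn_eq n m.+1).
apply: le_trans (hyp_subadditive _ _ _ _) _; apply: lerD; last first.
  by apply: aB; rewrite ltn_mod.
apply: le_trans (aM _ _) _; rewrite mulrAC ler_pdivlMr// mulrAC [leRHS]mulrC.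
by rewrite ler_wpM2r// -natrM ler_nat leq_trunc_div.
Unshelve. all: by end_near.
Qed.

Lemma stable_length_le d e (K C : R) (x y : G) : 0 <= K ->
  (forall n, d 1%g (x ^+ n)%g <= K * e 1%g (y ^+ n)%g + C) ->
  stable_length d x <= K * stable_length e y.
Proof.
move=> K0 le; have cn : C / n%:R @[n --> \oo] --> (0 : R).
  rewrite -(mulr0 C); apply: cvgM; first exact: cvg_cst.
  apply/gtr0_cvgV0; last exact/cvgrnyP/cvg_id.
  by near=> n; rewrite ltr0n; near: n; exists 1%N.
have h : (fun n => K * len e y n + C / n%:R) @ \oo --> K * stable_length e y.
  rewrite -[X in _ --> X]addr0; apply: cvgD cn.
  by apply: cvgM; [exact: cvg_cst|exact: stable_length_cvg].
apply: (ler_cvg_to (@stable_length_cvg d x) h).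
apply: nearW => n /=; rewrite mulrA -mulrDl ler_wpM2r ?invr_ge0//.
Unshelve. all: by end_near.
Qed.

Lemma stable_length_ge0 d x : 0 <= stable_length d x.
Proof.
have [d0 _ _ _] := hdist_pseudo_metric d.
apply: (limr_ge (cvgP _ (@stable_length_cvg d x))).
by apply: nearW => n; rewrite divr_ge0.
Qed.

Lemma stable_lengthJ d x g : stable_length d (x ^ g)%g = stable_length d x.
Proof.
have [d0 _ dC dT] := hdist_pseudo_metric d.
suff h y h : stable_length d (y ^ h)%g <= stable_length d y.
  by apply/eqP; rewrite eq_le h/= -[X in stable_length d X <= _](conjgK g) h.
rewrite -[leRHS]mul1r; apply: (@stable_length_le _ _ _ (d 1%g h + d 1%g h)) => // n.
rewrite mul1r -conjXg conjgE.
rewrite -(hdist_left_invariant d h) mulg1 mulVKg addrCA.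
apply: le_trans (dT _ 1%g _) _; rewrite [d h 1%g]dC lerD2l.
apply: le_trans (dT _ (y ^+ n)%g _) _; rewrite lerD2l.
by rewrite -[X in d X _](mulg1 (y ^+ n)%g) hdist_left_invariant.
Qed.

Lemma stable_length_classE d x :
  stable_length_class d (conj_class x) = stable_length d x.
Proof.
rewrite /stable_length_class.
by case: xgetP => [_ -> [g _ <-]|/(_ x)[]]; [rewrite stable_lengthJ|exists 1%g; rewrite ?conjg1].
Qed.

End StableLength.

Section Dilation.
Variables (R : realType) (G : groupType).
Implicit Types (d e f : hypMetric R G) (x y g : G).

Let ratios d e := [set stable_length d x / stable_length e x | x in @non_torsion G].

Lemma DilE d e : Dil d e = sup (ratios d e).
Proof.
rewrite /Dil /conj' image_comp; congr (sup (_ @` _)).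
by apply/funext => x /=; rewrite !stable_length_classE.
Qed.

Lemma stable_length_equiv d e :
  exists2 K : R, 0 <= K & forall x, stable_length d x <= K * stable_length e x.
Proof.
have [K K0 [C dKe]] := hyp_le_affine d e.
by exists K => // x; apply: stable_length_le K0 _ => n; exact: dKe.
Qed.

Lemma stable_length_eq0 d e x : stable_length e x = 0 -> stable_length d x = 0.
Proof.
move=> ex0; have [K _ /(_ x)] := stable_length_equiv d e.
by rewrite ex0 mulr0 => h; apply/eqP; rewrite eq_le h stable_length_ge0.
Qed.

Lemma stable_length_ratio_le d e (K : R) x : 0 <= K ->
  stable_length d x <= K * stable_length e x ->
  stable_length d x / stable_length e x <= K.
Proof.
move=> K0 dKe; have [e0|e0] := eqVneq (stable_length e x) 0.
  by rewrite e0 invr0 mulr0.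
by rewrite ler_pdivrMr// lt_neqAle eq_sym e0 stable_length_ge0.
Qed.

Lemma ratios_ub d e : has_ubound (ratios d e).
Proof.
have [K K0 dKe] := stable_length_equiv d e.
by exists K => _ [y _ <-]; apply: stable_length_ratio_le.
Qed.

Lemma Dil_le d e (B : R) : 0 <= B ->
  (forall x, non_torsion x -> stable_length d x <= B * stable_length e x) ->
  Dil d e <= B.
Proof.
move=> B0 dB; rewrite DilE.
have [->|/set0P r0] := eqVneq (ratios d e) set0; first by rewrite sup0.
apply: ge_sup => // _ [x ntx <-]; apply: stable_length_ratio_le => //.
exact: dB.
Qed.

Lemma stable_length_Dil d e x : non_torsion x ->
  stable_length d x <= Dil d e * stable_length e x.
Proof.
move=> ntx; have [e0|e0] := eqVneq (stable_length e x) 0.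
  by rewrite (stable_length_eq0 d e0) e0 mulr0.
rewrite -ler_pdivrMr; last by rewrite lt_neqAle eq_sym e0 stable_length_ge0.
by rewrite DilE; apply: ub_le_sup (ratios_ub d e) _ _; exists x.
Qed.

Lemma Dil_ge0 d e : 0 <= Dil d e.
Proof.
rewrite DilE; have [->|/set0P[r rr]] := eqVneq (ratios d e) set0.
  by rewrite sup0.
apply: le_trans (ub_le_sup (ratios_ub d e) rr).
by case: rr => x _ <-; rewrite divr_ge0// stable_length_ge0.
Qed.

Lemma Dil_triangle d e f : Dil d f <= Dil d e * Dil e f.
Proof.
apply: Dil_le => [|x ntx]; first by rewrite mulr_ge0// Dil_ge0.
apply: le_trans (stable_length_Dil d e ntx) _.
by rewrite -mulrA ler_wpM2l ?Dil_ge0// stable_length_Dil.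
Qed.

Lemma Dil_refl_le1 d : Dil d d <= 1.
Proof. by apply: Dil_le => // x _; rewrite mul1r. Qed.

Lemma Dil_gt0_or_eq0 :
  (forall d e, 0 < Dil d e) \/ (forall d e, Dil d e = 0).
Proof.
have [[[d0 x] /= ntx dx]|h] := pselect (exists2 u : hypMetric R G * G,
    non_torsion u.2 & stable_length u.1 u.2 != 0).
  left=> d e; rewrite lt_neqAle Dil_ge0 andbT eq_sym.
  apply: contra dx => /eqP de0; apply/eqP/(@stable_length_eq0 _ d).
  apply/eqP; rewrite eq_le stable_length_ge0 andbT.
  by have := stable_length_Dil d e ntx; rewrite de0 mul0r.
right=> d e; apply/eqP; rewrite eq_le Dil_ge0 andbT.
apply: Dil_le => // x ntx; rewrite mul0r; apply/contraT; rewrite -ltNge => dx.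
by exfalso; apply: h; exists (d, x) => //=; rewrite gt_eqF.
Qed.

Definition hyp_Delta d e : R := ln (Dil d e * Dil e d).

Lemma hyp_DeltaC d e : hyp_Delta d e = hyp_Delta e d.
Proof. by rewrite /hyp_Delta mulrC. Qed.

Lemma hyp_Delta_triangle d e f : hyp_Delta d f <= hyp_Delta d e + hyp_Delta e f.
Proof.
rewrite /hyp_Delta; have [D0|D0] := Dil_gt0_or_eq0; last first.
  by rewrite !D0 !mul0r ln0// addr0.
rewrite -lnM ?posrE ?mulr_gt0// ler_ln ?posrE ?mulr_gt0//.
by rewrite mulrACA [X in _ <= _ * X]mulrC ler_pM ?Dil_ge0// Dil_triangle.
Qed.

Lemma roughly_similar_Delta_le0 d e : roughly_similar d e -> hyp_Delta d e <= 0.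
Proof.
move=> [tau [C [tau0 C0 de]]]; rewrite /hyp_Delta.
have Dde : Dil d e <= tau^-1.
  apply: Dil_le => [|x _]; first by rewrite invr_ge0 ltW.
  apply: (@stable_length_le _ _ _ _ _ (C / tau)) => [|n].
    by rewrite invr_ge0 ltW.
  rewrite [tau^-1 * _]mulrC -mulrDl ler_pdivlMr// mulrC.
  by have /ler_normlP[_] := de 1%g (x ^+ n)%g; rewrite lerBlDl.
have Ded : Dil e d <= tau.
  apply: Dil_le => [|x _]; first exact: ltW.
  apply: (@stable_length_le _ _ _ _ _ C) => [|n]; first exact: ltW.
  by have /ler_normlP[+ _] := de 1%g (x ^+ n)%g; rewrite opprB lerBlDl.
apply: ln_le0; rewrite -[leRHS](mulVf (lt0r_neq0 tau0)).
by rewrite ler_pM// Dil_ge0.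
Qed.

End Dilation.

Section MetricStructures.
Variables (R : realType) (G : groupType).
Implicit Types d e f : hypMetric R G.

Definition roughly_similarb d e : bool := `[< roughly_similar d e >].

Lemma roughly_similarb_refl : reflexive roughly_similarb.
Proof.
move=> d; apply/asboolP; exists 1, 1; split=> // x y.
by rewrite mul1r subrr normr0.
Qed.

Lemma roughly_similarb_sym : symmetric roughly_similarb.
Proof.
suff h d e : roughly_similarb d e -> roughly_similarb e d.
  by move=> d e; apply/idP/idP; exact: h.
move=> /asboolP[tau [C [tau0 C0 de]]]; apply/asboolP.
exists tau^-1, (tau^-1 * C); split=> [||x y]; rewrite ?mulr_gt0 ?invr_gt0//.
have -> : tau^-1 * e x y - d x y = - (tau^-1 * (tau * d x y - e x y)).
  by rewrite mulrBr mulKf ?lt0r_neq0// opprB.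
by rewrite normrN normrM gtr0_norm ?invr_gt0// ler_pM2l ?invr_gt0.
Qed.

Lemma roughly_similarb_trans : transitive roughly_similarb.
Proof.
move=> e d f /asboolP[t [C [t0 C0 de]]] /asboolP[u [B [u0 B0 ef]]].
apply/asboolP; exists (u * t), (u * C + B).
split=> [||x y]; rewrite ?addr_gt0 ?mulr_gt0//.
have -> : u * t * d x y - f x y
    = u * (t * d x y - e x y) + (u * e x y - f x y).
  by rewrite mulrBr addrA subrK mulrA.
apply: le_trans (ler_normD _ _) _; rewrite lerD// normrM gtr0_norm//.
by rewrite ler_pM2l.
Qed.

Canonical roughly_similar_equiv := EquivRel roughly_similarb
  roughly_similarb_refl roughly_similarb_sym roughly_similarb_trans.

Definition metricStruct := {eq_quot roughly_similar_equiv}.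

HB.instance Definition _ := Choice.on metricStruct.
HB.instance Definition _ := EqQuotient.on metricStruct.

Definition struct_class d : metricStruct := \pi_metricStruct d.

Lemma struct_classP d e : struct_class d = struct_class e <-> roughly_similar d e.
Proof.
by split=> [/eqmodP de|de]; [exact/asboolP|apply/eqmodP/asboolP].
Qed.

(* Independent of the representatives, see DeltaE below. *)
Definition Delta (a b : metricStruct) : R :=
  ln (Dil (repr a) (repr b) * Dil (repr b) (repr a)).

Lemma DeltaE d e : Delta (struct_class d) (struct_class e) = hyp_Delta d e.
Proof.
have rep f : roughly_similar (repr (struct_class f)) f.
  by apply/struct_classP; rewrite /struct_class reprK.
have per f : roughly_similar f (repr (struct_class f)).
  by apply/struct_classP; rewrite /struct_class reprK.
have h (a b a' b' : hypMetric R G) : roughly_similar a a' ->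
    roughly_similar b' b -> hyp_Delta a b <= hyp_Delta a' b'.
  move=> aa bb; apply: le_trans (hyp_Delta_triangle a a' b) _.
  apply: le_trans (lerD (roughly_similar_Delta_le0 aa)
    (hyp_Delta_triangle a' b' b)) _.
  by rewrite add0r gerDl roughly_similar_Delta_le0.
by apply/eqP; rewrite eq_le !h.
Qed.

Let Delta_ball (a : metricStruct) (eps : R) : set metricStruct :=
  [set b | Delta a b < eps].

Let Delta_ball_center a (eps : R) : 0 < eps -> Delta_ball a eps a.
Proof.
by apply: le_lt_trans; apply: ln_le0; rewrite mulr_ile1 ?Dil_ge0 ?Dil_refl_le1.
Qed.

Let Delta_ball_sym a b (eps : R) : Delta_ball a eps b -> Delta_ball b eps a.
Proof. by rewrite /Delta_ball/= /Delta mulrC. Qed.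

Let Delta_ball_triangle a b c (eps1 eps2 : R) :
  Delta_ball a eps1 b -> Delta_ball b eps2 c -> Delta_ball a (eps1 + eps2) c.
Proof.
move=> ab bc; apply: le_lt_trans (ltrD ab bc).
exact: hyp_Delta_triangle.
Qed.

Let Delta_nbhs (a : metricStruct) : set_system metricStruct :=
  nbhs_ (entourage_ Delta_ball) a.

(* Only a pseudometric structure is declared: that Delta separates points is
   a theorem on hyperbolic groups. The topology is that of the Delta-balls. *)
HB.instance Definition _ := hasNbhs.Build metricStruct Delta_nbhs.

HB.instance Definition _ := @Nbhs_isPseudoMetric.Build R metricStruct
  (entourage_ Delta_ball) erefl Delta_ball
  Delta_ball_center Delta_ball_sym Delta_ball_triangle erefl.

Lemma ball_Delta (a : metricStruct) (eps : R) :
  ball a eps = [set b | Delta a b < eps].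
Proof. by []. Qed.

End MetricStructures.

(* Main.v *)
Require Import Defs.
From mathcomp Require Import all_boot all_order all_algebra.
From mathcomp Require Import finmap.
From mathcomp Require Import all_classical all_reals all_analysis.
From mathcomp Require Import lra zify.
Import Order.TTheory GRing.Theory Num.Theory.
Import numFieldNormedType.Exports.

Set Implicit Arguments.
Unset Strict Implicit.
Unset Printing Implicit Defensive.

Local Open Scope classical_set_scope.
Local Open Scope ring_scope.

(** Let l and l' be the stable length functions of d and e = dstar, and let m and
    M be the infimum and the supremum of l' / l on the elements of positive length,
    so that m = (Dil d e)^-1 and M = Dil e d. The geodesic consists of linear
    combinations a d + b e, with one negative coefficient outside the segment from
    d to e. Such a combination has length function a l + b l', which is at least a
    positive multiple of l exactly when a + b m and a + b M are positive. Under
    this condition it is within bounded distance of a genuine left-invariant hyperbolic pseudo metric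
    ([combination]). The ratio of two such length functions is a Moebius, hence
    monotone, function of l' / l, so that its extreme values are those at m and
    at M, and Delta is the difference of the numbers ln ((a + b M) / (a + b m)).
    This number is 0 at d and ln (M / m) at e, and takes every real value once up
    to scaling: used as a parameter it gives an isometric embedding of the real
    line ([geodesic_line]). It remains to rescale the parameter so that e is
    reached at its growth rate, which must be positive for this
    ([growth_rate_gt0]).

    That m < M and that the combinations are hyperbolic both rest on two facts.

    The first is that two metrics in the class have the same coarse geodesics
    ([morse]), hence common branching points p for all triples
    ([common_center]). The Gromov product of x and y at z for a d + b e is then
    a d(z, p) + b e(z, p) up to a bounded error, so it is bounded below when the
    combination is, and the hyperbolic inequality holds because the branching
    points lie along geodesics. No geodesics are available beforehand:
    [rough_geodesic] first builds them from paths of word length comparable to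
    the distance, using that a detour at height D costs a length exponential in D
    ([gp_chain]).

    The second is that, up to a bounded error, the norms d(1, x) and e(1, x) are
    the stable lengths of one same element y ([norm_stable_length]). This y is
    x f with f bounded, chosen by [divergence] so that y and y^-1 point in
    different directions; then d(1, y^n) grows linearly by the four-point
    condition. The element f exists because a non-elementary group does not fix,
    even coarsely, a point at infinity ([displacement]). In particular,
    proportional length functions come from roughly similar metrics, so that
    m < M. The element f of [divergence] also lets one multiply long elements
    with almost no cancellation, which gives exponential growth. *)

(** * Real numbers and finite sets *)

Lemma linear_le_exp2 (c : nat) :
  exists k0 : nat, forall k, (k0 <= k)%N -> (c * k.+1 <= 2 ^ k)%N.
Proof.
exists (c + c).+2 => k /subnK <-; elim: (k - _)%N => [|j IHj].
  rewrite add0n !expnS expnD; have := ltn_expl c (isT : (1 < 2)%N); nia.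
by rewrite addSn expnS; have := ltn_expl (j + (c + c).+2) (isT : (1 < 2)%N); nia.
Qed.

(** This ends the arguments by exponential divergence: there D is the distance
    from a point to a path of length at most al * D + be, and k is the number of
    successive bisections that reduce this path to single steps. *)
Lemma log_bound (R : realType) (A al be dl : R) :
  0 <= al -> 0 <= be -> 0 <= dl ->
  exists D0 : R, forall D,
    (forall k : nat, al * D + be <= (2 ^ k)%:R -> D <= A + dl * k%:R) -> D <= D0.
Proof.
move=> al0 be0 dl0; pose c := (Num.truncn (al * (`|A| + (dl + 1)) + be)).+1.
have [k0 k0P] := linear_le_exp2 c.
have cP : al * (`|A| + (dl + 1)) + be <= c%:R by rewrite ltW// truncnS_gt.
exists (A + (dl + 1) * k0%:R) => D hD; rewrite leNgt; apply/negP => ltD.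
pose k := Num.truncn ((D - A) / (dl + 1)).
have dl1 : 0 < dl + 1 by lra.
have q0 : 0 <= (D - A) / (dl + 1).
  rewrite divr_ge0//; last lra.
  have : 0 <= (dl + 1) * k0%:R by rewrite mulr_ge0//; lra.
  lra.
have /andP[k1 k2] := truncn_itv q0.
rewrite -/k ler_pdivlMr// in k1; rewrite -/k ltr_pdivrMr// in k2.
have k0k : (k0 <= k)%N.
  have : k0%:R < k.+1%:R :> R by rewrite -(ltr_pM2r dl1); lra.
  by rewrite ltr_nat.
have /(_ k) := hD; have : al * D + be <= (2 ^ k)%:R.
  apply: (@le_trans _ _ (c * k.+1)%:R); last by rewrite ler_nat k0P.
  rewrite natrM; apply: (@le_trans _ _ ((al * (`|A| + (dl + 1)) + be) * k.+1%:R)).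
    have A1 : A <= `|A| by exact: ler_norm.
    have k1' : 1 <= k.+1%:R :> R by rewrite ler1n.
    have DA : D <= (`|A| + (dl + 1)) * k.+1%:R.
      have : `|A| * 1 <= `|A| * k.+1%:R by rewrite ler_wpM2l.
      lra.
    rewrite mulrDl lerD//; first by rewrite -mulrA ler_wpM2l.
    by rewrite ler_peMr.
  by rewrite ler_wpM2r.
move=> h /(_ h) => hD'.
have kb : (0 : R) <= k%:R by [].
have [kz|kz] := eqVneq k 0%N.
  move: hD' ltD; rewrite kz mulr0.
  have : 0 <= (dl + 1) * k0%:R by rewrite mulr_ge0//; lra.
  lra.
have : 0 < k%:R :> R by rewrite ltr0n lt0n.
lra.
Qed.

(** Take for j the first time above b, and for i the last time before j that is
    below a. *)
Lemma crossing (R : realType) (f : nat -> R) (N : nat) (a b : R) :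
  a < b -> f 0%N <= a -> b <= f N ->
  exists i j, [/\ (i < j)%N, (j <= N)%N, f i <= a, b <= f j &
    forall k, (i < k < j)%N -> a < f k < b].
Proof.
move=> ab f0 fN.
have exj : exists j, b <= f j by exists N.
case: (ex_minnP exj) => j fj jmin.
have j0 : (0 < j)%N.
  rewrite lt0n; apply/eqP => j0; move: fj; rewrite j0; lra.
have exi : exists i, (i < j)%N && (f i <= a) by exists 0%N; rewrite j0 f0.
have ubi i : (i < j)%N && (f i <= a) -> (i <= j)%N by case/andP=> /ltnW.
case: (ex_maxnP exi ubi) => i /andP[ij fi] imax.
exists i, j; split => //; first exact: jmin.
move=> k /andP[ik kj]; rewrite !ltNge; apply/andP; split; apply/negP => h.
  by have := imax k; rewrite kj h leqNgt ik => /(_ isT).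
by have := jmin k h; rewrite leqNgt kj.
Qed.

Lemma finite_bound (R : realType) (T : choiceType) (A : set T) (f : T -> R) :
  finite_set A -> exists2 M : R, 0 <= M & forall x, A x -> f x <= M.
Proof.
case/finite_seqP => l ->; exists (\sum_(x <- l) `|f x|); first exact: sumr_ge0.
move=> x /= xl; rewrite (big_rem x) //=; apply: le_trans (ler_norm _) _.
by rewrite lerDl sumr_ge0.
Qed.

(** * Coarse geometry of hyperbolic metrics *)

Section CoarseGeometry.
Variables (R : realType) (G : groupType).
Implicit Types (d e : hypMetric R G) (x y z w g p q : G).
Local Notation gp := (@gromov_product R G).

Lemma hyp_ge0 d x y : 0 <= d x y.
Proof. by have [] := hdist_pseudo_metric d. Qed.

Lemma hyp_xx d x : d x x = 0.
Proof. by have [] := hdist_pseudo_metric d. Qed.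

Lemma hyp_sym d x y : d x y = d y x.
Proof. by have [] := hdist_pseudo_metric d. Qed.

Lemma hyp_tri d x y z : d x z <= d x y + d y z.
Proof. by have [] := hdist_pseudo_metric d. Qed.

Lemma hyp_inv d g x y : d (g * x)%g (g * y)%g = d x y.
Proof. exact: hdist_left_invariant. Qed.

Lemma gpE d z x y : gp d z x y = (d z x + d z y - d x y) / 2.
Proof. by rewrite /gromov_product (hyp_sym d x z). Qed.

Lemma gpC d z x y : gp d z x y = gp d z y x.
Proof. by rewrite !gpE (hyp_sym d x y); lra. Qed.

Lemma gpxx d x y : gp d x y y = d x y.
Proof. by rewrite gpE hyp_xx; lra. Qed.

Lemma gp_ge0 d z x y : 0 <= gp d z x y.
Proof. by rewrite gpE; have := hyp_tri d x z y; rewrite (hyp_sym d x z); lra. Qed.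

Lemma gp_le d z x y : gp d z x y <= d z x.
Proof. by rewrite gpE; have := hyp_tri d z x y; lra. Qed.

Lemma gp_split d x y p : gp d x p y + gp d p x y = d x p.
Proof. by rewrite !gpE (hyp_sym d p x); lra. Qed.

Lemma gp_inv d g z x y : gp d (g * z)%g (g * x)%g (g * y)%g = gp d z x y.
Proof. by rewrite !gpE !hyp_inv. Qed.

Lemma gp_lip d z x x' y : gp d z x y <= gp d z x' y + d x x'.
Proof.
rewrite !gpE; have := hyp_tri d z x' x; have := hyp_tri d x' x y.
by rewrite (hyp_sym d x' x); lra.
Qed.

Lemma gp_lip_base d z z' x y : gp d z x y <= gp d z' x y + d z z'.
Proof. by rewrite !gpE; have := hyp_tri d z z' x; have := hyp_tri d z z' y; lra. Qed.

Definition hyp_const d (dl : R) := 0 <= dl /\ forall x y z w,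
  gp d z x w - dl <= gp d z x y \/ gp d z w y - dl <= gp d z x y.

Lemma hyp_constP d : exists dl, hyp_const d dl.
Proof.
have [dl dl0 h] := hdist_hyperbolic d; exists dl; split => // x y z w.
have := h x y z w; rewrite minEle; case: ifP => _; lra.
Qed.

(** Iterating the hyperbolic inequality along a dyadic subdivision costs one
    constant per level; this is the source of the exponential divergence. *)
Lemma gp_chain d dl k : hyp_const d dl ->
  forall N (p : nat -> G) z m, (0 < N <= 2 ^ k)%N ->
  (forall i, (i < N)%N -> m <= gp d z (p i) (p i.+1)) ->
  m - dl * k%:R <= gp d z (p 0%N) (p N).
Proof.
move=> [dl0 hyp]; elim: k => [|k IHk] N p z m /andP[N0 Nk] hm.
  have -> : N = 1%N by rewrite expn0 in Nk; lia.
  by rewrite mulr0 subr0 hm.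
rewrite -natr1; have [Nk'|Nk'] := leqP N (2 ^ k)%N.
  have := IHk N p z m; rewrite N0 Nk' => /(_ isT hm); lra.
have h1 := IHk (2 ^ k)%N p z m; rewrite expn_gt0 leqnn in h1.
have {}h1 := h1 isT (fun i ik => hm i (ltn_trans ik Nk')).
have h2 := IHk (N - 2 ^ k)%N (fun i => p (2 ^ k + i)%N) z m.
have {}h2 : m - dl * k%:R <= gp d z (p (2 ^ k)%N) (p N).
  move: h2; rewrite addn0 subnKC ?(ltnW Nk')//; apply.
    rewrite expnS in Nk; apply/andP; split; lia.
  by move=> i iN; rewrite addnS; apply: hm; lia.
by case: (hyp (p 0%N) (p N) z (p (2 ^ k)%N)); lra.
Qed.

Definition coarse_path d (M : R) (N : nat) (p : nat -> G) :=
  forall i, (i < N)%N -> d (p i) (p i.+1) <= M.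

(** Word geodesics are the only paths given at the start; that their length is
    linear in the distance is all that is used of them. *)
Lemma word_path d : exists M K : R, [/\ 0 <= M, 0 <= K & forall x y,
  exists N (p : nat -> G), [/\ p 0%N = x, p N = y, coarse_path d M N p &
    N%:R <= K * d x y + K]].
Proof.
have [S gS [L [C [L1 C0 qi _]]]] := hdist_word d; have [fS _ _] := gS.
have [M M0 MP] := finite_bound (d 1%g) fS.
exists M, (L + C); split => [//||x y]; first lra.
have [s [sS sxy] ws] := @word_metric_attained R G S x y gS.
exists (size s), (fun i => (x * \prod_(g <- take i s) g)%g); split.
- by rewrite take0 big_nil mulg1.
- by rewrite take_size sxy mulVKg.
- move=> i is_; rewrite (take_nth 1%g is_) -cats1 big_cat big_seq1 mulgA.
  rewrite -[X in d X _]mulg1 hyp_inv MP//; apply: sS; exact: mem_nth.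
- have /andP[_] := qi x y; rewrite ws => h; apply: le_trans h _.
  by have := hyp_ge0 d x y; have := mulr_ge0 C0 (hyp_ge0 d x y); lra.
Qed.

(** Think of gp d x p y as the level, counted from x, at which the point p
    projects to the geodesic from x to y, and of gp d p x y as its height over
    this geodesic. At bounded height, the distance is the difference of levels. *)
Lemma level_dist d dl x y p q : hyp_const d dl ->
  d p q <= gp d p x y + gp d q x y
           + `|gp d x p y - gp d x q y| + 2 * dl.
Proof.
move=> [dl0 hyp].
have hp := gp_split d x y p; have hq := gp_split d x y q.
have := ler_norm (gp d x p y - gp d x q y).
have := ler_norm (gp d x q y - gp d x p y); rewrite (distrC (gp d x q y)).
have : d p q = d x p + d x q - 2 * gp d x p q.
  by rewrite gpE; lra.
by have := hyp p q x y; rewrite (gpC d x y q) => -[]; lra.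
Qed.

Lemma level_lip d x y p q : `|gp d x p y - gp d x q y| <= d p q.
Proof.
have h1 := gp_lip d x p q y; have h2 := gp_lip d x q p y.
rewrite (hyp_sym d q p) in h2.
by rewrite ler_norml; apply/andP; split; lra.
Qed.

End CoarseGeometry.

Section RoughGeodesics.
Variables (R : realType) (G : groupType).
Implicit Types (d e : hypMetric R G) (x y z w g p q : G).
Local Notation gp := (@gromov_product R G).

Lemma gp_step d z x y : d z x - d x y <= gp d z x y.
Proof. by rewrite gpE; have := hyp_tri d z y x; rewrite (hyp_sym d y x); lra. Qed.

(** Let D be such that every level between x and y carries a point of height at
    most D. A word path between two such points on both sides of a given level
    has length linear in D and crosses this level. If the whole crossing were
    at height more than D - 1, [gp_chain] would make this length exponential in
    D; so D can be lowered by 1 until it reaches a constant that does not depend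
    on x and y. *)
Lemma rough_geodesic d : exists A : R, 0 <= A /\ forall x y s, 0 <= s <= d x y ->
  exists p, `|gp d x p y - s| <= A /\ gp d p x y <= A.
Proof.
have [dl hd] := hyp_constP d; have [dl0 hyp] := hd.
have [M [K [M0 K0 wp]]] := word_path d.
(* Levels in the window of half-width k1 about s differ by more than dl across
   the window; k2 adds one step of the path. *)
pose k1 := dl + 1; pose k2 := k1 + M.
have k1E : k1 = dl + 1 by []. have k2E : k2 = dl + 1 + M by [].
have [||//|D0 D0P] := @log_bound R (2 * M + dl + 1) (2 * K)
  (K * (2 * k1 + 4 * k2 + 2 * dl) + K) dl; first lra.
  by rewrite addr_ge0// mulr_ge0//; lra.
clearbody k1 k2.
exists (`|D0| + 1 + k2); split; first by have := normr_ge0 D0; lra.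
move=> x y s sxy.
pose lev p := gp d x p y.
pose Pr D := forall s, 0 <= s <= d x y ->
  exists p, `|lev p - s| <= k2 /\ gp d p x y <= D.
have levx : lev x = 0.
  by have := gp_le d x x y; have := gp_ge0 d x x y; rewrite hyp_xx /lev; lra.
have levy : lev y = d x y by exact: gpxx.
have hty : gp d y x y = 0.
  by have := gp_le d y y x; have := gp_ge0 d y x y; rewrite hyp_xx gpC; lra.
suff : Pr (`|D0| + 1).
  move=> /(_ s sxy)[p [ps hp]]; exists p; split.
    by apply: le_trans ps _; have := normr_ge0 D0; lra.
  by apply: le_trans hp _; lra.
move=> {s sxy}.
(* A first bound on heights, depending on x and y: the length of a path. *)
have [n Prn] : exists n : nat, Pr (`|D0| + 1 + n%:R).
  have [N [p [p0 pN pM _]]] := wp x y.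
  have dp i : (i <= N)%N -> d x (p i) <= M * i%:R.
    elim: i => [|i IHi] iN; first by rewrite p0 hyp_xx mulr0.
    have := hyp_tri d x (p i) (p i.+1); have := pM i iN.
    by have := IHi (ltnW iN); rewrite -natr1; lra.
  exists (Num.truncn (M * N%:R)).+1 => r /andP[r0 rxy].
  have exj : exists j, r <= lev (p j) by exists N; rewrite pN levy.
  case: (ex_minnP exj) => l fl lmin.
  have lN : (l <= N)%N by apply: lmin; rewrite pN levy.
  exists (p l); split.
    case: l fl lmin lN => [|l] fl lmin lN.
      move: fl; rewrite p0 levx => fl; have -> : r = 0 by lra.
      by rewrite subrr normr0; lra.
    have : lev (p l) < r by rewrite ltNge; apply/negP => /lmin; rewrite ltnn.
    have /ler_normlP[] := level_lip d x y (p l) (p l.+1).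
    have := pM l lN; rewrite -!/(lev _) => h1 h2 h3 h4.
    by rewrite ger0_norm; lra.
  have := dp l lN; have := gp_split d x y (p l); have := gp_ge0 d x (p l) y.
  have : M * l%:R <= M * N%:R by rewrite ler_wpM2l// ler_nat.
  have := truncnS_gt (M * N%:R); have := normr_ge0 D0; lra.
elim: n Prn => [|n IHn] Prn; first by rewrite -[_ + 1]addr0.
apply: IHn; set D := `|D0| + 1 + n.+1%:R in Prn.
have DE : D = `|D0| + 1 + n%:R + 1 by rewrite /D -natr1; lra.
have nn : 0 <= n%:R :> R by [].
have -> : `|D0| + 1 + n%:R = D - 1 by lra.
have [D1 D0D] : 1 <= D /\ D0 < D.
  by have := normr_ge0 D0; have := ler_norm D0; split; lra.
clear DE nn; clearbody D.
move=> s /andP[s0 sxy].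
have [sk|sk] := ltP s k1.
  exists x; rewrite -/(lev x) levx; split; last lra.
  by rewrite sub0r normrN ger0_norm; lra.
have [sk'|sk'] := ltP (d x y) (s + k1).
  exists y; rewrite levy hty; split; last lra.
  by rewrite ger0_norm; lra.
apply: contrapT => hno.
have hD p : `|lev p - s| <= k2 -> D - 1 < gp d p x y.
  by move=> hp; rewrite ltNge; apply/negP => hp'; apply: hno; exists p.
(* Start and end of the detour: points of height at most D slightly below and
   slightly above the window, or the endpoints x and y themselves. *)
have [x' [x'1 x'2 x'3]] : exists x', [/\ s - k1 - 2 * k2 <= lev x',
    lev x' <= s - k1 & gp d x' x y <= D].
  have [h|h] := leP 0 (s - k1 - k2).
    have [|p [/ler_normlP[h1 h2] hp]] := Prn (s - k1 - k2); first lra.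
    by exists p; split => //; lra.
  by exists x; rewrite -/(lev x) levx; split; lra.
have [y' [y'1 y'2 y'3]] : exists y', [/\ lev y' <= s + k1 + 2 * k2,
    s + k1 <= lev y' & gp d y' x y <= D].
  have [h|h] := leP (s + k1 + k2) (d x y).
    have [|p [/ler_normlP[h1 h2] hp]] := Prn (s + k1 + k2); first lra.
    by exists p; split => //; lra.
  by exists y; rewrite levy hty; split; lra.
clear levx levy hty s0 sxy sk sk'.
have [N [p [p0 pN pM NK]]] := wp x' y'.
have [||/= |i [j [ij jN fi fj fij]]] :=
    @crossing R (fun i => lev (p i)) N (s - k1) (s + k1); first lra.
- by rewrite p0.
- by rewrite pN.
have lip l : (l < N)%N -> `|lev (p l) - lev (p l.+1)| <= M.
  by move=> lN; apply: le_trans (level_lip _ _ _ _ _) (pM _ lN).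
(* During the crossing the path stays in the larger window, where hD applies. *)
have win l : (i <= l < j)%N -> `|lev (p l) - s| <= k2.
  move=> /andP[il lj]; have /ler_normlP[l1 l2] := lip l (leq_trans lj jN).
  move: il; rewrite leq_eqVlt => /predU1P[il|il]; last first.
    by have := fij l; rewrite il lj => /(_ isT)/andP[h1 h2]; apply/ler_normlP; split; lra.
  subst l; apply/ler_normlP; split; last lra.
  move: lj; rewrite leq_eqVlt => /predU1P[lj|lj]; first by rewrite lj in l1; lra.
  by have := fij i.+1; rewrite leqnn lj => /(_ isT)/andP[h1 h2]; lra.
have : D <= D0.
  apply: D0P => k Nk.
  have dxy : d x' y' <= 2 * D + (2 * k1 + 4 * k2) + 2 * dl.
    apply: le_trans (level_dist x y x' y' hd) _.
    have : `|lev x' - lev y'| <= 2 * k1 + 4 * k2.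
      by clear fi fj x'3 y'3; apply/ler_normlP; split; lra.
    by rewrite /lev; lra.
  have jiN : (j - i <= 2 ^ k)%N.
    rewrite -(ler_nat R); apply: le_trans Nk; apply: (@le_trans _ _ N%:R).
      by rewrite ler_nat (leq_trans (leq_subr _ _)).
    by apply: le_trans NK _; have := ler_wpM2l K0 dxy; lra.
  have step t : (t < j - i)%N ->
      s - k2 + (D - 1) - M <= gp d x (p (i + t)%N) (p (i + t.+1)%N).
    move=> tj; have il : (i <= i + t < j)%N by rewrite leq_addr -ltn_subRL.
    rewrite addnS; apply: le_trans (gp_step _ _ _ _).
    have iN : (i + t < N)%N by case/andP: il => _ /leq_trans; apply.
    have := pM (i + t)%N iN; have := gp_split d x y (p (i + t)%N).
    have /ler_normlP[] := win _ il; have := hD _ (win _ il); rewrite /lev; lra.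
  have := gp_chain hd _ step; rewrite addn0 subnKC ?(ltnW ij)//.
  rewrite subn_gt0 ij => /(_ k jiN).
  have := hyp (p i) y x (p j); move: fi fj; rewrite /lev.
  by move=> fi fj [] ; lra.
lra.
Qed.

End RoughGeodesics.

Section Morse.
Variables (R : realType) (G : groupType).
Implicit Types (d e : hypMetric R G) (x y z w g p q : G).
Local Notation gp := (@gromov_product R G).

(** Points of bounded height with regularly increasing levels from q to q'; the
    sign of t covers both orders of the levels of q and q'. *)
Lemma geodesic_path e (A : R) : 0 <= A ->
  (forall x y s, 0 <= s <= e x y ->
     exists p, `|gp e x p y - s| <= A /\ gp e p x y <= A) ->
  exists2 M, 0 <= M & forall x y q q', gp e q x y <= A -> gp e q' x y <= A ->
    exists N (r : nat -> G), [/\ r 0%N = q, r N = q', coarse_path e M N r,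
      (forall i, (i <= N)%N -> gp e (r i) x y <= A) &
      (0 < N)%N /\ N%:R <= e q q' + 1].
Proof.
move=> A0 rg; have [dl he] := hyp_constP e; have [dl0 _] := he.
exists (4 * A + 1 + 2 * dl) => [|x y q q' hq hq']; first lra.
pose lev p := gp e x p y; pose D := lev q' - lev q.
pose N := (Num.truncn `|D|).+1.
have N0 : 0 < N%:R :> R by rewrite ltr0n.
pose t := D / N%:R.
have Nt : t * N%:R = D by rewrite /t divfK// gt_eqF.
have t1 : `|t| <= 1.
  by rewrite normrM normfV (gtr0_norm N0) ler_pdivrMr// mul1r ltW// truncnS_gt.
have levb p : 0 <= lev p <= e x y.
  by rewrite /lev gp_ge0 gpC gp_le.
have mid i : (i <= N)%N -> 0 <= lev q + t * i%:R <= e x y.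
  rewrite -(ler_nat R) => iN; have /andP[a1 a2] := levb q.
  have /andP[b1 b2] := levb q'; have i0 : 0 <= i%:R :> R by [].
  have DE : D = lev q' - lev q by [].
  have [tp|tp] := leP 0 t.
    have := ler_wpM2l tp iN; have := mulr_ge0 tp i0; lra.
  have tn : 0 <= - t by lra.
  have := ler_wpM2l tn iN; have := mulr_ge0 tn i0; lra.
have /choice[r rP] : forall i : nat, exists p, [/\ i = 0%N -> p = q,
    i = N -> p = q' & (i <= N)%N ->
    gp e p x y <= A /\ `|lev p - (lev q + t * i%:R)| <= A].
  move=> i; have [->|i0] := eqVneq i 0%N.
    by exists q; split => // _; split => //; rewrite mulr0 addr0 subrr normr0.
  have [->|iN] := eqVneq i N.
    exists q'; split => // _; split => //.
    have -> : lev q' - (lev q + t * N%:R) = 0 by rewrite Nt /D; lra.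
    by rewrite normr0.
  have [le|] := boolP (i <= N)%N; last first.
    by move=> nle; exists q; split => // h; exfalso; move: i0 iN; rewrite h ?eqxx.
  have [p [p1 p2]] := rg x y _ (mid i le).
  by exists p; split => // h; exfalso; move: i0 iN; rewrite h eqxx.
exists N, r; split.
- by have [->] := rP 0%N.
- by have [_ ->] := rP N.
- move=> i iN; have [_ _ /(_ (ltnW iN))[i1 i2]] := rP i.
  have [_ _ /(_ iN)[j1 j2]] := rP i.+1.
  apply: le_trans (level_dist x y _ _ he) _.
  move: i2 j2 t1; rewrite -natr1 !ler_norml => /andP[? ?] /andP[? ?] /andP[? ?].
  have : `|lev (r i) - lev (r i.+1)| <= 2 * A + 1.
    by rewrite ler_norml; apply/andP; split; lra.
  by rewrite /lev; lra.
- by move=> i iN; have [_ _ /(_ iN)[]] := rP i.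
- split => //; rewrite /N -natr1 lerD2r.
  have /andP[+ _] := truncn_itv (normr_ge0 D); move=> /le_trans; apply.
  by rewrite /D distrC; exact: level_lip.
Qed.

(** Suppose that every point of the d-geodesic from x to y is at distance at most
    D from the e-geodesic, and let p almost attain this bound. Going from p to
    distance 2D on both sides along the d-geodesic, and from there to the
    e-geodesic, one finds two points of the e-geodesic that p separates. The
    e-geodesic joins them outside the ball of radius D - 1 about p with a length
    linear in D, whereas [gp_chain] requires an exponential one. Hence D is
    bounded independently of x and y. *)
Lemma morse d e (A : R) :
  exists A', forall x y p, gp d p x y <= A -> gp e p x y <= A'.
Proof.
have [dl hd] := hyp_constP d; have [dl0 hyp] := hd.
have [Ad [Ad0 rgd]] := rough_geodesic d.
have [Ae [Ae0 rge]] := rough_geodesic e.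
have [M M0 pathe] := geodesic_path Ae0 rge.
have [K1 K10 [C1 de]] := hyp_le_affine d e.
have [K2 K20 [C2 ed]] := hyp_le_affine e d.
have C20 : 0 <= C2 by have := ed 1%g 1%g; rewrite !hyp_xx; lra.
have C10 : 0 <= C1 by have := de 1%g 1%g; rewrite !hyp_xx; lra.
(* With this lower bound on A, the auxiliary points x' below satisfy the same
   hypothesis as p. *)
wlog AE : A / Ad + dl <= A.
  move=> /(_ (`|A| + Ad + dl))[|A' hA']; first by have := normr_ge0 A; lra.
  exists A' => x y p hp; apply: hA'; apply: le_trans hp _.
  by have := ler_norm A; lra.
pose M2 := K1 * M + C1.
have [||//|D0 D0P] := @log_bound R (A + 2 * dl + 1 + M2) (6 * K2)
  (K2 * (4 * Ad) + C2 + 1) dl; first lra.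
  by have : 0 <= K2 * (4 * Ad); [rewrite mulr_ge0//; lra|lra].
(* At distances beyond D1, the additive errors below are negligible. *)
pose D1 := `|D0| + 3 * A + 3 * Ad + 6 * dl + 3.
exists (Ae + K2 * D1 + C2) => x y p hp.
pose Pr D := forall p, gp d p x y <= A -> exists q, gp e q x y <= Ae /\ d p q <= D.
suff /(_ p hp)[q [hq pq]] : Pr D1.
  have := gp_lip_base e p q x y; have := ed p q; have := ler_wpM2l K20 pq; lra.
have [n Prn] : exists n : nat, Pr (D1 + n%:R).
  exists (Num.truncn (d x y + A)).+1 => q hq; exists x; split.
    by apply: le_trans (gp_le _ _ _ _) _; rewrite hyp_xx.
  rewrite hyp_sym -(gp_split d x y q).
  have := gp_le d x y q; rewrite gpC; have := truncnS_gt (d x y + A).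
  by have := normr_ge0 D0; rewrite /D1; lra.
clear p hp; elim: n Prn => [|n IHn] Prn; first by rewrite -[D1]addr0.
apply: IHn; set D := D1 + n.+1%:R in Prn.
have DE : D = D1 + n%:R + 1 by rewrite /D -natr1; lra.
have nn : 0 <= n%:R :> R by [].
have DD1 : D1 + 1 <= D by lra.
have -> : D1 + n%:R = D - 1 by lra.
clear DE nn; clearbody D.
have [D0D DT] : D0 < D /\ 3 * A + 3 * Ad + 6 * dl + 4 <= D.
  have := normr_ge0 D0; have := ler_norm D0; have := dl0.
  by rewrite /D1 in DD1; split; lra.
clear DD1 C10 C20 M0.
move=> p hp; apply: contrapT => hno.
have far q : gp e q x y <= Ae -> D - 1 < d p q.
  by move=> hq; rewrite ltNge; apply/negP => pq; apply: hno; exists q.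
(* By symmetry, u = x gives the point on one side of p and u = y the other. *)
have side u v : (forall q, gp d q u v = gp d q x y) ->
    (forall q, gp e q u v = gp e q x y) ->
    exists q, [/\ gp e q x y <= Ae, D - Ad - dl - 1 <= gp d p u q &
      d p q <= 3 * D + 2 * Ad].
  move=> duv euv; have [pu|pu] := leP (d p u) (2 * D).
    have hu : gp e u x y <= Ae.
      by rewrite -euv; apply: le_trans (gp_le _ _ _ _) _; rewrite hyp_xx.
    by exists u; split=> //; rewrite ?gpxx; have := far _ hu; lra.
  have [|u' [/ler_normlP[u1 u2] u3]] := rgd p u (2 * D).
    by apply/andP; split; lra.
  have pu' := gp_split d p u u'.
  have h1 : gp d p u' v <= A + dl.
    by have := hp; rewrite -duv; have := hyp u v p u'; rewrite (gpC d p u u') => -[]; lra.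
  have h2 := gp_split d p v u'; rewrite (gpC d u') in h2.
  have hu' : gp d u' x y <= A.
    by rewrite -duv; have := hyp u p u' v; rewrite (gpC d u' u p) => -[]; lra.
  have [q [hq u'q]] := Prn _ hu'; exists q; split => //.
    have := gp_step d p u' q; have := gp_ge0 d u' p u; have := hyp u q p u'.
    by rewrite (gpC d p u u') => -[]; lra.
  by have := hyp_tri d p u' q; lra.
have [x' [hx' xx' px']] := side x y (fun=> erefl) (fun=> erefl).
have [y' [hy' yy' py']] := side y x (fun q => gpC d q y x) (fun q => gpC e q y x).
clear side.
have x'y' : gp d p x' y' <= A + 2 * dl.
  have h : gp d p x' y <= A + dl by case: (hyp x y p x'); lra.
  by have := hyp x' y p y'; rewrite (gpC d p y' y) => -[]; lra.
have [N [r [r0 rN rM rQ [N0 NK]]]] := pathe x y x' y' hx' hy'.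
have : D <= D0.
  apply: D0P => k Nk.
  have Nk' : (N <= 2 ^ k)%N.
    rewrite -(ler_nat R); apply: le_trans Nk; apply: le_trans NK _.
    have x'y'd : d x' y' <= 6 * D + 4 * Ad.
      by have := hyp_tri d x' p y'; rewrite (hyp_sym d x' p); lra.
    by have := ed x' y'; have := ler_wpM2l K20 x'y'd; lra.
  have step i : (i < N)%N -> D - 1 - M2 <= gp d p (r i) (r i.+1).
    move=> iN; apply: le_trans (gp_step _ _ _ _); have := far _ (rQ i (ltnW iN)).
    by have := de (r i) (r i.+1); have := ler_wpM2l K10 (rM i iN); rewrite /M2; lra.
  by have := gp_chain hd _ step; rewrite N0 r0 rN => /(_ k Nk'); lra.
lra.
Qed.

(** The point of the d-geodesic from x to y at level gp d x y z is the branching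
    point of the tripod x, y, z for d, hence also for e by [morse]. *)
Lemma common_center d e : exists2 A : R, 0 <= A & forall x y z, exists p,
  [/\ gp d p x y <= A, gp d p y z <= A & gp d p x z <= A] /\
  [/\ gp e p x y <= A, gp e p y z <= A & gp e p x z <= A].
Proof.
have [dl [dl0 hyp]] := hyp_constP d; have [Ad [Ad0 rgd]] := rough_geodesic d.
have [Ae hAe] := morse d e (2 * Ad + 2 * dl).
exists (`|Ae| + 2 * Ad + 2 * dl) => [|x y z].
  by have := normr_ge0 Ae; lra.
have Ae0 := ler_norm Ae; have Aen := normr_ge0 Ae.
have [|p [/ler_normlP[p1 p2] p3]] := rgd x y (gp d x y z).
  by rewrite gp_ge0 gp_le.
have [pxz pyz] : gp d p x z <= 2 * Ad + 2 * dl /\ gp d p y z <= 2 * Ad + 2 * dl.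
  have := hyp p z x y; move: p1 p2 p3; rewrite !gpE !(hyp_sym d p x).
  by move=> p1 p2 p3 []; split; lra.
exists p; split; split; try lra.
- by have := hAe x y p; lra.
- by have := hAe y z p pyz; lra.
- by have := hAe x z p pxz; lra.
Qed.

End Morse.

(** * Displacement of points by a non-elementary group *)

Lemma uniq_map_inj (T U : eqType) (f : T -> U) (s : seq T) :
  uniq (map f s) -> {in s &, injective f}.
Proof.
elim: s => // a s IHs /= /andP[fa us] x y; rewrite !inE.
move=> /predU1P[->|xs] /predU1P[->|ys] //; last exact: IHs.
  by move=> e; rewrite e map_f in fa.
by move=> e; rewrite -e map_f in fa.
Qed.

Section CyclicCosets.
Variables (G : groupType).
Implicit Types (g x y z : G).

Lemma cyclic_mul1 g z : cyclic_subgroup g z -> cyclic_subgroup g (g * z)%g.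
Proof.
move=> [n [->|->]]; first by exists n.+1; left; rewrite expgS.
case: n => [|n]; first by exists 1%N; left; rewrite expg0 invg1 mulg1.
by exists n; right; rewrite expgSr invgM mulVKg.
Qed.

Lemma cyclic_inv g z : cyclic_subgroup g z -> cyclic_subgroup g z^-1%g.
Proof. by move=> [n [->|->]]; exists n; [right|left; rewrite invgK]. Qed.

Lemma cyclic_mulV1 g z : cyclic_subgroup g z -> cyclic_subgroup g (g^-1 * z)%g.
Proof.
move=> [n [->|->]]; last by exists n.+1; right; rewrite expgSr invgM.
case: n => [|n]; first by exists 1%N; right; rewrite expg0 mulg1.
by exists n; left; rewrite expgS mulKg.
Qed.

Lemma cyclic_mul g y z :
  cyclic_subgroup g y -> cyclic_subgroup g z -> cyclic_subgroup g (y * z)%g.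
Proof.
move=> [n [->|->]] cz; elim: n => [|n IHn].
- by rewrite expg0 mul1g.
- by rewrite expgS -mulgA; apply: cyclic_mul1.
- by rewrite expg0 invg1 mul1g.
- by rewrite expgSr invgM -mulgA; apply: cyclic_mulV1.
Qed.

Lemma cyclic_1 g : cyclic_subgroup g 1%g.
Proof. by exists 0%N; left. Qed.

Lemma cyclic_gen g : cyclic_subgroup g g.
Proof. by exists 1%N; left. Qed.

Definition cyclic_coset g x : set G := [set (x * h)%g | h in cyclic_subgroup g].

Lemma cyclic_cosetM g x z :
  cyclic_subgroup g z -> cyclic_coset g (x * z)%g = cyclic_coset g x.
Proof.
move=> cz; apply/seteqP; split => y [h ch <-].
  by exists (z * h)%g; [exact: cyclic_mul|rewrite mulgA].
exists (z^-1 * h)%g; first exact: cyclic_mul (cyclic_inv cz) ch.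
by rewrite -mulgA mulVKg.
Qed.

Lemma infinite_index_reps g N : ~ virtually_cyclic G ->
  exists s : seq G, (N <= size s)%N /\ uniq (map (cyclic_coset g) s).
Proof.
move=> nvc; have inf : infinite_set (range (cyclic_coset g)).
  by move=> h; apply: nvc; exists g.
have [B Bsub BN] := infinite_set_fset N inf.
have /choice[rep repP] : forall c : set G, exists x : G,
    range (cyclic_coset g) c -> cyclic_coset g x = c.
  by move=> c; have [[x _ <-]|nc] := pselect (range (cyclic_coset g) c);
    [exists x|exists 1%g].
exists (map rep B); rewrite size_map; split => //.
rewrite -map_comp (_ : map _ _ = B) ?fset_uniq//.
rewrite -[RHS]map_id; apply/eq_in_map => c cB /=.
by apply: repP; exact: Bsub.
Qed.

End CyclicCosets.

Section Nonelementary.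
Variables (R : realType) (G : groupType) (d : hypMetric R G).
Implicit Types (x y z w g p q u v f : G) (n B rho : R).
Local Notation gp := (@gromov_product R G d).

Lemma norm_inv x : d 1%g x^-1%g = d 1%g x.
Proof. by rewrite -(hyp_inv d x) mulg1 mulgV hyp_sym. Qed.

Lemma norm_mul x y : d 1%g (x * y)%g <= d 1%g x + d 1%g y.
Proof.
apply: le_trans (hyp_tri d 1%g x (x * y)%g) _.
by rewrite -[X in d X (x * y)%g]mulg1 hyp_inv.
Qed.

(** Seen at scale n, such a u stands for a point at infinity that the ball of
    radius n fixes. *)
Definition almost_fixed n u :=
  forall f, d 1%g f <= n -> n < gp 1%g u (f * u)%g.

(** This is the Busemann function of u at f^-1, that is the amount by which f
    shifts the horospheres about u. *)
Definition busemann u f : R := d 1%g (f * u)%g - d 1%g u.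

Lemma dist_mulV f u : d 1%g (f * u)%g = d f^-1%g u.
Proof. by rewrite -(hyp_inv d f f^-1%g) mulgV. Qed.

Lemma busemann_le u f : `|busemann u f| <= d 1%g f.
Proof.
rewrite /busemann dist_mulV; have := hyp_tri d 1%g f^-1%g u.
have := hyp_tri d f^-1%g 1%g u; rewrite (hyp_sym d _ 1%g) norm_inv.
by rewrite ler_norml => h1 h2; apply/andP; split; lra.
Qed.

(** Since g almost fixes u, the Busemann functions of u and g u differ by a
    constant on the ball of radius n. *)
Lemma busemann_quasimorphism dl n u f g : hyp_const d dl -> almost_fixed n u ->
  d 1%g f <= n -> d 1%g g <= n ->
  `|busemann u (f * g)%g - busemann u f - busemann u g| <= 2 * dl.
Proof.
move=> [dl0 hyp] fixu fn gn; rewrite /busemann -mulgA !(dist_mulV f).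
have := fixu _ gn; set y := f^-1%g; set v := (g * u)%g.
have y1 : d 1%g y <= n by rewrite norm_inv.
have := hyp y u 1%g v; have := hyp y v 1%g u.
rewrite (gpC d 1%g v u); have := gp_le d 1%g y u; have := gp_le d 1%g y v.
move: y1; rewrite !gpE => y1 a1 a2 b1 b2 uv; rewrite ler_norml.
by case: b1; case: b2 => b1 b2; apply/andP; split; lra.
Qed.

(** Let p be a far point of the geodesic from 1 to u. As f almost fixes u, the
    point f p is on this geodesic as well, up to a bounded distance, and the shift
    of f is the difference of the levels of f p and p. *)
Lemma small_shift_displacement B : 0 <= B -> exists C T : R, [/\ 0 <= C, 0 <= T &
  forall n u rho, almost_fixed n u -> 0 <= rho -> rho + T <= n ->
  exists p, forall f, d 1%g f <= rho -> `|busemann u f| <= B ->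
    d p (f * p)%g <= C].
Proof.
move=> B0; have [dl [dl0 hyp]] := hyp_constP d; have [A [A0 rg]] := rough_geodesic d.
exists (3 * B + 20 * A + 20 * dl + 2), (2 * A + dl + 1); split; try lra.
move=> n u rho fixu rho0 rhon.
have n1 : d 1%g 1%g <= n by rewrite hyp_xx; lra.
have := fixu _ n1; rewrite mul1g gpxx => nu.
have [|p [/ler_normlP[p1 p2] p3]] := rg 1%g u (rho + (2 * A + dl + 1)).
  by apply/andP; split; lra.
exists p => f frho; rewrite /busemann; set v := (f * u)%g; set q := (f * p)%g.
move=> /ler_normlP[b1 b2].
have q1 : gp q f v <= A by rewrite -[X in gp _ X _]mulg1 gp_inv.
have q2 : gp f q v = gp 1%g p u by rewrite -[X in gp X _ _]mulg1 gp_inv.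
have qv : d q v = d p u by rewrite hyp_inv.
have sq := gp_split d f v q; have sq1 := gp_split d f 1%g q.
have sv := gp_split d 1%g v q; have su := gp_split d 1%g u p.
have fv : gp f q 1%g <= d 1%g f.
  by rewrite gpC hyp_sym; exact: gp_le.
have hgt : gp q 1%g v <= A + dl.
  by have := gp_ge0 d q f v; case: (hyp f v q 1%g); lra.
have d1q : `|d 1%g q - (d 1%g v - d 1%g u + d 1%g p)| <= 2 * (A + dl).
  move: hgt (gp_ge0 d q 1%g v) p3 (gp_ge0 d p 1%g u); rewrite !gpE.
  rewrite (hyp_sym d q 1%g) (hyp_sym d p 1%g) qv => *.
  by rewrite ler_norml; apply/andP; split; lra.
move/ler_normlP: d1q => [d1 d2].
have uv : n < gp 1%g u v by apply: fixu; lra.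
have uq : rho - B - 3 * A - 4 * dl <= gp 1%g u q.
  have := gp_ge0 d p 1%g u; have := gp_ge0 d q 1%g v; have := hyp u q 1%g v.
  by rewrite (gpC d 1%g v q); case; lra.
have pq : rho - B - 3 * A - 5 * dl <= gp 1%g p q.
  by case: (hyp p q 1%g u); lra.
by move: pq; rewrite gpE; lra.
Qed.

(** Multiplying f by g or g^-1 moves its shift towards 0 by at least 1 and at most
    Cg + 2 * dl, so that the shift cannot jump over the target interval. *)
Lemma small_shift_reach dl (n Cg : R) u g : hyp_const d dl -> almost_fixed n u ->
  d 1%g g <= Cg -> busemann u g <= - (2 * dl + 1) ->
  forall (j : nat) f, `|busemann u f| <= j%:R -> d 1%g f + Cg * j%:R <= n ->
  exists z, [/\ cyclic_subgroup g z, d 1%g (z * f)%g <= d 1%g f + Cg * j%:R &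
    `|busemann u (z * f)%g| <= Cg + 2 * dl].
Proof.
move=> hd fixu gC bg; have [dl0 _] := hd.
have Cg0 : 0 <= Cg by apply: le_trans gC; exact: hyp_ge0.
have /ler_normlP[g1 g2] := busemann_le u g.
elim=> [|j IHj] f bf fn.
  exists 1%g; rewrite mul1g; split; [exact: cyclic_1|lra|].
  by apply: le_trans bf _; lra.
have [small|] := leP `|busemann u f| (Cg + 2 * dl).
  exists 1%g; rewrite mul1g; split => //; first exact: cyclic_1.
  by have := mulr_ge0 Cg0 (ler0n R j.+1); lra.
have f0 := hyp_ge0 d 1%g f; have jC := mulr_ge0 Cg0 (ler0n R j).
move: bf fn; rewrite -natr1 => bf fn.
rewrite lter_normr => /orP[bp|bn].
  have /ler_normlP[c1 c2] : `|busemann u (g * f)%g - busemann u g - busemann u f|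
    <= 2 * dl by apply: busemann_quasimorphism hd fixu _ _; lra.
  move/ler_normlP: bf => [e1 e2].
  have nf := norm_mul g f.
  have [||z [cz z1 z2]] := IHj (g * f)%g.
  - by rewrite ler_norml; apply/andP; split; lra.
  - lra.
  exists (z * g)%g; rewrite -mulgA; split => //; last lra.
  by apply: cyclic_mul => //; exact: cyclic_gen.
have nf := norm_mul g^-1%g f; rewrite norm_inv in nf.
have := @busemann_quasimorphism dl n u g (g^-1 * f)%g hd fixu.
rewrite mulVKg => qm; have /ler_normlP[c1 c2] := qm ltac:(lra) ltac:(lra).
move/ler_normlP: bf => [e1 e2].
have [||z [cz z1 z2]] := IHj (g^-1 * f)%g.
- by rewrite ler_norml; apply/andP; split; lra.
- lra.
exists (z * g^-1)%g; rewrite -mulgA; split => //; last lra.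
by apply: cyclic_mul => //; apply: cyclic_inv; exact: cyclic_gen.
Qed.

(** Otherwise some u is almost fixed at an arbitrarily large scale. A point p0 of
    the geodesic from 1 to u gives an element g with a definite shift, and the
    right cosets of the cyclic group of g that meet a given ball contain elements
    of small shift ([small_shift_reach]). Conjugation by a far point p of the
    geodesic sends these injectively into a ball of fixed radius
    ([small_shift_displacement]), which bounds the index of this cyclic group. *)
Lemma displacement : ~ virtually_cyclic G ->
  exists r : R, forall u, exists f, d 1%g f <= r /\ gp 1%g u (f * u)%g <= r.
Proof.
move=> nvc; apply: contrapT => nex.
have fixed (n : R) : exists u, almost_fixed n u.
  apply: contrapT => nfix; apply: nex; exists n => u.
  apply: contrapT => nf; apply: nfix; exists u => f fn.
  by rewrite ltNge; apply/negP => h; apply: nf; exists f.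
have [dl hd] := hyp_constP d; have [dl0 hyp] := hd.
have [A [A0 rg]] := rough_geodesic d.
(* The point at level t0 gives an element of shift at most - (2 * dl + 1), larger
   in size than the defect of the quasi-morphism. *)
pose t0 := 3 * A + 2 * dl + 1; pose Cg := t0 + 2 * A.
have Cg0 : 0 <= Cg by rewrite /Cg /t0; lra.
have [|C [T [C0 T0 disp]]] := @small_shift_displacement (Cg + 2 * dl); first lra.
pose ball := fset_set [set x | d 1%g x < C + 1].
(* The scale must be chosen before u, hence before g: rho0 bounds the coset
   representatives for all the finitely many possible g at once. *)
have /choice[s sP] := fun g => infinite_index_reps g (size ball).+1 nvc.
have /choice[b bP] : forall g : G, exists b : R, forall x, x \in s g -> d 1%g x <= b.
  move=> g; have [b _ bP] := finite_bound (d 1%g) (finite_seq (s g)).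
  by exists b => x; exact: bP.
have [rho0 rho00 rho0P] := finite_bound b (hyp_ball_finite d (Cg + 1)).
pose j := (Num.truncn rho0).+1.
have jP : rho0 <= j%:R by rewrite ltW// truncnS_gt.
have jC : 0 <= Cg * j%:R by rewrite mulr_ge0.
pose rho := rho0 + Cg * j%:R; have rhoE : rho = rho0 + Cg * j%:R by [].
have t00 : 0 <= t0 by rewrite /t0; lra.
have [u fixu] := fixed (rho + T + t0).
have [p0 [/ler_normlP[p1 p2] p3]] : exists p, `|gp 1%g p u - t0| <= A /\
    gp p 1%g u <= A.
  apply: rg; have := fixu 1%g; rewrite hyp_xx mul1g gpxx => h.
  by apply/andP; split => //; have := h ltac:(lra); lra.
pose g := p0^-1%g.
have gC : d 1%g g <= Cg.
  by rewrite norm_inv -(gp_split d 1%g u p0) /Cg; lra.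
have bg : busemann u g <= - (2 * dl + 1).
  rewrite /busemann dist_mulV invgK; move: p2 p1 p3.
  by rewrite !gpE (hyp_sym d p0 1%g) /t0; lra.
have [sN suniq] := sP g.
have gball : b g <= rho0 by apply: rho0P => /=; lra.
have [||p pP] := disp _ u rho fixu; [lra|lra|].
have reach x : exists z, x \in s g ->
    cyclic_subgroup g z /\ d p (z * x^-1 * p)%g <= C.
  have [xs|_] := boolP (x \in s g); last by exists 1%g.
  have xrho : d 1%g x^-1%g <= rho0 by rewrite norm_inv; apply: le_trans gball; exact: bP.
  have bx := busemann_le u x^-1%g.
  have [||z [cz z1 z2]] := small_shift_reach hd fixu gC bg (j := j) (f := x^-1%g).
  - by apply: le_trans jP; exact: le_trans xrho.
  - lra.
  by exists z => _; split => //; apply: pP => //; lra.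
have /choice[z zP] := reach.
(* Coset representatives x are inverted, to pass from left to right cosets. *)
pose phi x := (p^-1 * (z x * x^-1 * p))%g.
suff : (size (map phi (s g)) <= size ball)%N.
  by rewrite size_map leqNgt => /negP; apply.
apply: uniq_leq_size.
  rewrite map_inj_in_uniq; first by apply: map_uniq suniq.
  move=> x y xs ys; rewrite /phi => /mulgI/mulIg e.
  have [cx _] := zP x xs; have [cy _] := zP y ys.
  have cc : cyclic_coset g x = cyclic_coset g y.
    rewrite -(cyclic_cosetM x (cyclic_inv cx)) -(cyclic_cosetM y (cyclic_inv cy)).
    by congr cyclic_coset; apply: invg_inj; rewrite !invgM !invgK.
  exact: (uniq_map_inj suniq) cc.
move=> _ /mapP[x xs ->]; have [_ zx] := zP x xs.
rewrite in_fset_set; last exact: hyp_ball_finite.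
by rewrite inE /= -(hyp_inv d p) mulg1 mulVKg; lra.
Qed.

End Nonelementary.

(** * Stable lengths *)

Section StableLengths.
Variables (R : realType) (G : groupType).
Implicit Types (d e : hypMetric R G) (x y z w g p q u v f : G).
Local Notation gp := (@gromov_product R G).

(** With f as in [displacement], v cannot point in the direction of both u and
    f u, so either 1 or f will do. *)
Lemma divergence d : ~ virtually_cyclic G ->
  exists r : R, 0 <= r /\
    forall u v, exists f, d 1%g f <= r /\ gp d 1%g v (f * u)%g <= r.
Proof.
move=> /(displacement d)[r0 disp]; have [dl [dl0 hyp]] := hyp_constP d.
have r00 : 0 <= r0.
  by have [f [f0 _]] := disp 1%g; apply: le_trans f0; exact: hyp_ge0.
exists (r0 + dl); split=> [|u v]; first lra.
have [f [fr fu]] := disp u.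
have [h|h] := leP (gp d 1%g v (f * u)%g) (r0 + dl).
  by exists f; split => //; lra.
exists 1%g; rewrite hyp_xx mul1g; split; first lra.
by have := hyp u (f * u)%g 1%g v; rewrite (gpC d 1%g v u); case; lra.
Qed.

Lemma stable_length_le_norm d x : stable_length d x <= d 1%g x.
Proof.
apply: (limr_le (cvgP _ (@stable_length_cvg R G d x))).
apply: nearW => n; have [->|n0] := eqVneq n 0%N.
  by rewrite invr0 mulr0; exact: hyp_ge0.
rewrite ler_pdivrMr ?ltr0n ?lt0n//; elim: n {n0} => [|n IHn].
  by rewrite expg0 hyp_xx mulr0.
by rewrite expgS -natr1; have := norm_mul d x (x ^+ n)%g; lra.
Qed.

(** The four-point condition on 1, x, x^2 and x^(n+1) makes the sequence of the
    d 1 (x^n) grow by the left-hand side at each step. *)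
Lemma stable_length_ge d dl x : hyp_const d dl ->
  d 1%g (x ^+ 2)%g - d 1%g x - 2 * dl <= stable_length d x.
Proof.
move=> [dl0 hyp]; set t := (X in X <= _).
have [t0|t0] := leP t 0; first by apply: le_trans t0 (stable_length_ge0 _ _).
pose a n := d 1%g (x ^+ n)%g.
have a1 : a 1%N = d 1%g x by [].
have tE : t = a 2%N - a 1%N - 2 * dl by [].
have inc n : a n + t <= a n.+1.
  elim: n => [|n IHn].
    have := norm_mul d x x; rewrite /a expg0 hyp_xx add0r => h.
    by rewrite /t expgS expg1; lra.
  have := hyp 1%g (x ^+ 2)%g x (x ^+ n.+2)%g; rewrite !gpE.
  have -> : d x 1%g = a 1%N by rewrite hyp_sym.
  have -> : d x (x ^+ 2)%g = a 1%N.
    by rewrite -[X in d X _]mulg1 expgS hyp_inv expg1.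
  have -> : d x (x ^+ n.+2)%g = a n.+1.
    by rewrite -[X in d X _]mulg1 (expgS x n.+1) hyp_inv.
  have -> : d (x ^+ n.+2)%g (x ^+ 2)%g = a n.
    by rewrite hyp_sym (expgnDr x 2 n) -[X in d X _]mulg1 hyp_inv.
  by rewrite -/(a 2%N) -/(a n.+2); case; lra.
have an n : n%:R * t <= a n.
  elim: n => [|n IHn]; first by rewrite mul0r; exact: hyp_ge0.
  by rewrite -natr1; have := inc n; lra.
apply: (limr_ge (cvgP _ (@stable_length_cvg R G d x))).
near=> n; have n0 : (0 < n)%N by near: n; exists 1%N.
by rewrite ler_pdivlMr ?ltr0n// mulrC; exact: an.
Unshelve. all: by end_near.
Qed.

(** The element f of [divergence] for x^-1 and x makes y = x f^-1 and its inverse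
    point in different directions, for d and then by [morse] for e. So 1 is close
    to an axis of y and [stable_length_ge] applies to both metrics. *)
Lemma norm_stable_length d e : ~ virtually_cyclic G ->
  exists C : R, 0 <= C /\ forall x, exists y,
    `|d 1%g x - stable_length d y| <= C /\ `|e 1%g x - stable_length e y| <= C.
Proof.
move=> nvc; have [r [r0 div]] := divergence d nvc.
have [dl hd] := hyp_constP d; have [dl' he] := hyp_constP e.
have [dl0 _] := hd; have [dl'0 _] := he.
have [A hA] := morse d e (2 * r).
have [K K0 [C ed]] := hyp_le_affine e d.
exists (`|A| * 2 + 2 * dl' + `|C| + K * r + 5 * r + 2 * dl).
have Kr : 0 <= K * r by rewrite mulr_ge0.
have An := normr_ge0 A; have Cn := normr_ge0 C.
have Al := ler_norm A; have Cl := ler_norm C.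
split=> [|x]; first lra.
have [f [fr gf]] := div x^-1%g x; pose y := (x * f^-1)%g.
have yV : (y^-1 = f * x^-1)%g by rewrite invgM invgK.
have xy (b : hypMetric R G) : b x y = b 1%g f.
  by rewrite -[X in b X y]mulg1 hyp_inv norm_inv.
have sq (b : hypMetric R G) : b 1%g (y ^+ 2)%g = 2 * b 1%g y - 2 * gp b 1%g y y^-1%g.
  rewrite gpE norm_inv -(hyp_inv b y y) mulgV expgS expg1 hyp_sym; lra.
have near (b : hypMetric R G) : `|b 1%g x - b 1%g y| <= b 1%g f.
  have := hyp_tri b 1%g x y; have := hyp_tri b 1%g y x.
  by rewrite (hyp_sym b y x) xy ler_norml => *; apply/andP; split; lra.
have gd : gp d 1%g y y^-1%g <= 2 * r.
  rewrite yV; have := gp_lip d 1%g y x (f * x^-1)%g.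
  by rewrite (hyp_sym d y x) xy; lra.
have ge := hA _ _ _ gd.
have ef : e 1%g f <= K * r + C by have := ed 1%g f; have := ler_wpM2l K0 fr; lra.
exists y; split; rewrite ler_norml; apply/andP; split.
- by have := near d; have := stable_length_le_norm d y; rewrite ler_norml => ? /andP[]; lra.
- by have := near d; have := stable_length_ge y hd; rewrite sq ler_norml => ? /andP[]; lra.
- by have := near e; have := stable_length_le_norm e y; rewrite ler_norml => ? /andP[]; lra.
- by have := near e; have := stable_length_ge y he; rewrite sq ler_norml => ? /andP[]; lra.
Qed.

Lemma stable_length_gt0_exists d : ~ virtually_cyclic G ->
  exists x, 0 < stable_length d x.
Proof.
move=> nvc; have [C [C0 hC]] := norm_stable_length d d nvc.
apply: contrapT => npos; apply: nvc; exists 1%g.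
apply: finite_image; apply: sub_finite_set (hyp_ball_finite d (C + 1)) => x _ /=.
have [y [+ _]] := hC x; rewrite ler_norml => /andP[_].
have : stable_length d y <= 0 by rewrite leNgt; apply/negP => h; apply: npos; exists y.
lra.
Qed.

Lemma stable_length_gt0_non_torsion d x : 0 < stable_length d x -> non_torsion x.
Proof.
move=> x0 n xn; suff : stable_length d x <= 0 * stable_length d x.
  by rewrite mul0r; lra.
have [M _ MP] := finite_bound (fun k => d 1%g (x ^+ k)%g) (finite_II n.+1).
apply: (@stable_length_le _ _ _ _ _ M) => // k; rewrite mul0r add0r.
rewrite (divn_eq k n.+1) expgnDr mulnC expgnA xn expg1n mul1g.
by apply: MP => /=; rewrite ltn_mod.
Qed.

End StableLengths.

(** * Positivity of the growth rate *)

Section Growth.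
Variables (R : realType) (G : groupType) (d : hypMetric R G).
Implicit Types (x y z w g p q u v f : G).
Local Notation gp := (@gromov_product R G d).

(** Bounded annuli would give balls of linear size, but the union of infinitely
    many cosets of an infinite cyclic subgroup grows faster. *)
Lemma large_annulus N : ~ virtually_cyclic G ->
  exists (a : nat) (s : seq G), [/\ uniq s, (N <= size s)%N &
    forall x, x \in s -> a%:R <= d 1%g x < a.+1%:R].
Proof.
have arith (n p k j : nat) : (n * p < j -> n * (p + j * k) < (n * k).+1 * j)%N.
  by nia.
move=> nvc; apply: contrapT => nann.
have fin a : finite_set [set x | a%:R <= d 1%g x < a.+1%:R].
  by apply: sub_finite_set (hyp_ball_finite d a.+1%:R) => x /= /andP[].
pose ann a : seq G := finmap.enum_fset (fset_set [set x | a%:R <= d 1%g x < a.+1%:R]).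
have annP a x : (x \in ann a) = (a%:R <= d 1%g x < a.+1%:R).
  by rewrite /ann in_fset_set//; apply/idP/idP; rewrite inE.
have annN a : (size (ann a) <= N)%N.
  rewrite leqNgt; apply/negP => /ltnW aN; apply: nann; exists a, (ann a).
  by split => //; [exact: fset_uniq|move=> x; rewrite annP].
have ball n : exists l : seq G, (size l <= N * n)%N /\
    forall x, d 1%g x < n%:R -> x \in l.
  elim: n => [|n [l [lN lP]]].
    by exists [::]; split => // x; have := hyp_ge0 d 1%g x; lra.
  exists (ann n ++ l); split; first by rewrite size_cat mulnS leq_add.
  move=> x xn; rewrite mem_cat annP xn andbT.
  by case: leP => //= /lP.
have [g g0] := stable_length_gt0_exists d nvc.
have gnt := stable_length_gt0_non_torsion g0.
have ginj i j : (g ^+ i)%g = (g ^+ j)%g -> i = j.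
  wlog ij : i j / (i <= j)%N.
    by move=> h e; case: (leqP i j) => [|/ltnW] ij; [|symmetry]; apply: h.
  move=> e; have := expgnFr g ij; rewrite e mulgV => e1.
  case ji : (j - i)%N e1 => [|k]; last by move/gnt.
  by move=> _; apply/eqP; rewrite eqn_leq ij -subn_eq0 ji.
pose K := (Num.truncn (d 1%g g)).+1; have gK : d 1%g g < K%:R by exact: truncnS_gt.
have [s [sN suniq]] := infinite_index_reps g (N * K).+1 nvc.
have [b _ bP] := finite_bound (d 1%g) (finite_seq s).
pose P := (Num.truncn b).+1; have bPl : b < P%:R by exact: truncnS_gt.
pose J := (N * P).+1; have [l [lN lP]] := ball (P + J * K)%N.
pose t := [seq (x * g ^+ j)%g | x <- s, j <- iota 0 J].
have : (size t <= size l)%N.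
  apply: uniq_leq_size.
    apply: allpairs_uniq; [exact: map_uniq suniq|exact: iota_uniq|].
    move=> p q hp hq; case/allpairsP: hp => -[x1 i1] /= [xs _ ->].
    case/allpairsP: hq => -[y1 j1] /= [ys _ ->] /= e.
    have xy : x1 = y1.
      apply: (uniq_map_inj suniq) => //.
      rewrite -(@cyclic_cosetM _ g x1 (g ^+ i1)%g); last by exists i1; left.
      by rewrite e cyclic_cosetM//; exists j1; left.
    by move: e; rewrite xy => /mulgI/ginj ->.
  move=> z /allpairsP[[x j] [xs + ->]]; rewrite mem_iota add0n => /andP[_ jJ] /=.
  rewrite [(x, j).1]/= in xs; rewrite [(x, j).2]/= in jJ.
  apply: lP; rewrite natrD natrM; have xb := bP x xs.
  have gj : d 1%g (g ^+ j)%g <= j%:R * d 1%g g.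
    elim: j {jJ} => [|j IHj]; first by rewrite mul0r hyp_xx.
    by rewrite expgS -natr1; have := norm_mul d g (g ^+ j)%g; lra.
  have : j%:R * d 1%g g <= J%:R * K%:R.
    by apply: ler_pM; rewrite ?hyp_ge0// ?ler_nat; [exact: ltnW|exact: ltW].
  by have := norm_mul d x (g ^+ j)%g; lra.
rewrite size_allpairs size_iota => h; have {h} := leq_trans h lN.
apply/negP; rewrite -ltnNge; apply: (@leq_trans ((N * K).+1 * J)%N); last first.
  by rewrite leq_mul2r sN orbT.
exact: arith.
Qed.

(** In a product x f y with f chosen by [divergence], x is within bounded
    distance of the geodesic to the product, so that its norm and the product
    determine it up to a bounded error. Hence the number of such products is at
    least a constant fraction of the number of pairs (x, y). *)
Lemma exponential_growth : ~ virtually_cyclic G ->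
  exists c : nat, (0 < c)%N /\ forall k, exists l : seq G,
    [/\ uniq l, (2 ^ k <= size l)%N & forall z, z \in l -> d 1%g z <= (c * k)%:R].
Proof.
move=> nvc; have [dl hd] := hyp_constP d; have [dl0 hyp] := hd.
have [r [r0 div]] := divergence d nvc.
have /choice[F FP] : forall p : G * G, exists f, d 1%g f <= r /\
    gp 1%g p.1^-1%g (f * p.2)%g <= r by move=> p; exact: div.
pose bl (C : R) : seq G := finmap.enum_fset (fset_set [set x | d 1%g x < C + 1]).
have blP C x : d 1%g x <= C -> x \in bl C.
  by move=> xC; rewrite in_fset_set; [rewrite inE /=; lra|exact: hyp_ball_finite].
pose C := 3 * r + 1 + 2 * dl.
have C0 : 0 <= C by rewrite /C; lra.
pose N0 := (size (bl C) * size (bl r))%N.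
have N00 : (0 < N0)%N.
  rewrite muln_gt0; apply/andP; split.
    by have := @blP C 1%g; rewrite hyp_xx => /(_ C0); case: (bl C).
  by have := @blP r 1%g; rewrite hyp_xx => /(_ r0); case: (bl r).
have [a [s [suniq sN sP]]] := large_annulus (2 * N0) nvc.
pose c := (a.+1 + (Num.truncn r).+1)%N.
exists c; split=> //; elim=> [|k [l [luniq lk lP]]].
  by exists [:: 1%g]; split => // z; rewrite inE => /eqP ->; rewrite hyp_xx.
pose ph (p : G * G) := (p.1 * F p * p.2)%g.
pose P := [seq (x, y) | x <- s, y <- l].
have Puniq : uniq P by apply: allpairs_uniq => // -[x y] [x' y'] _ _ [-> ->].
have PP (p : G * G) : p \in P -> p.1 \in s /\ p.2 \in l.
  by move=> /allpairsP[q [q1 q2 ->]].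
pose l' := undup (map ph P); exists l'; split; first exact: undup_uniq.
- have /choice[x0 x0P] : forall z, exists x, forall p : G * G, p \in P -> ph p = z ->
      d x p.1 <= C.
    move=> z; have [[p pP pz]|no] := pselect (exists2 p : G * G, p \in P & ph p = z); last first.
      by exists 1%g => p pP pz; exfalso; apply: no; exists p.
    exists p.1 => q qP qz.
    have hgt (t : G * G) : ph t = z -> gp t.1 1%g z <= r.
      move=> <-; have [_] := FP t; rewrite -(gp_inv d t.1) mulg1 mulgV /ph.
      by rewrite mulgA.
    have lev (t : G * G) : t \in P -> ph t = z -> a%:R - r <= gp 1%g t.1 z <= a.+1%:R.
      move=> /PP[/sP/andP[t1 t2] _] tz; have := hgt t tz.
      have := gp_split d 1%g z t.1; have := gp_ge0 d t.1 1%g z.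
      by move=> *; apply/andP; split; lra.
    apply: le_trans (level_dist 1%g z _ _ hd) _.
    have := hgt p pz; have := hgt q qz.
    have /andP[p1 p2] := lev p pP pz; have /andP[q1 q2] := lev q qP qz.
    have : `|gp 1%g p.1 z - gp 1%g q.1 z| <= r + 1.
      by move: p2 q2; rewrite -natr1 ler_norml => *; apply/andP; split; lra.
    by rewrite /C; lra.
  pose ps (p : G * G) := (ph p, ((x0 (ph p))^-1 * p.1, F p))%g.
  have : (size (map ps P) <=
      size [seq (z, b) | z <- l', b <- [seq (b1, b2) | b1 <- bl C, b2 <- bl r]])%N.
    apply: uniq_leq_size.
      rewrite map_inj_in_uniq// => -[x y] [x' y'] _ _ [] e1; rewrite e1.
      move=> /mulgI /= e2 e3; move: e1; rewrite /ph /= e3 e2 => /mulgI ->.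
      by [].
    move=> _ /mapP[p pP ->]; apply/allpairsP.
    exists (ph p, ((x0 (ph p))^-1 * p.1, F p))%g; split => //=.
      by rewrite mem_undup map_f.
    apply/allpairsP; exists ((x0 (ph p))^-1 * p.1, F p)%g; split => //=.
      apply: blP; rewrite -(hyp_inv d (x0 (ph p))) mulg1 mulVKg; exact: x0P.
    by apply: blP; have [] := FP p.
  rewrite size_map !size_allpairs -/N0 => h.
  have : (2 * N0 * 2 ^ k <= size l' * N0)%N.
    by apply: leq_trans h; rewrite leq_mul.
  by rewrite mulnAC -expnS leq_mul2r eqn0Ngt N00.
- move=> z; rewrite mem_undup => /mapP[p /PP[p1 p2] ->].
  have /andP[_ q1] := sP _ p1; have q2 := lP _ p2; have [q3 _] := FP p.
  have := norm_mul d (p.1 * F p)%g p.2; have := norm_mul d p.1 (F p).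
  have cE : c%:R = a.+1%:R + (Num.truncn r).+1%:R :> R by rewrite -natrD.
  by have := truncnS_gt r; rewrite /ph mulnS natrD cE; lra.
Qed.

(** An element of norm less than n is a word of length at most c * (n + 1), where
    c does not depend on n. *)
Lemma ball_card_le : exists2 b : nat, (0 < b)%N &
  forall n : nat, (#|` fset_set [set x | (d 1%g x < n%:R)%R]| <= b ^ n.+1)%N.
Proof.
have [S gS [L [C [L1 C0 qi _]]]] := hdist_word d; have [fS _ _] := gS.
have /finite_seqP[l lS] := fS.
pose W := fix W k : seq G :=
  if k is k'.+1 then [seq (g * h)%g | g <- 1%g :: l, h <- W k'] else [:: 1%g].
have WS k : W k.+1 = [seq (g * h)%g | g <- 1%g :: l, h <- W k] by [].
have WP k s : (size s <= k)%N -> (forall g, g \in s -> S g) ->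
    (\prod_(g <- s) g)%g \in W k.
  elim: k s => [|k IHk] s; first by case: s => // _ _; rewrite big_nil inE.
  rewrite WS => sk sS; apply/allpairsP; case: s sk sS => [_ _|g s sk sS].
    exists (1%g, 1%g); split => //=; first exact: mem_head.
      by have := IHk [::]; rewrite big_nil; apply.
    by rewrite big_nil mulg1.
  exists (g, \prod_(j <- s) j)%g; split => /=; last by rewrite big_cons.
    by have := sS g; rewrite lS /= !inE eqxx => /(_ isT) ->; rewrite orbT.
  by apply: IHk => // h hs; apply: sS; rewrite inE hs orbT.
have Wsize k : size (W k) = ((size l).+1 ^ k)%N.
  by elim: k => // k IHk; rewrite WS size_allpairs IHk expnS.
pose c := (Num.truncn (L + C)).+1.
have cP : L + C < c%:R by exact: truncnS_gt.
exists ((size l).+1 ^ c)%N => [|n]; first by rewrite expn_gt0.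
rewrite -expnM -Wsize; apply: uniq_leq_size; first exact: fset_uniq.
move=> x xball; have xn : d 1%g x < n%:R.
  by move: xball; rewrite in_fset_set; [rewrite inE|exact: hyp_ball_finite].
have [s [sS sx] ws] := @word_metric_attained R G S 1%g x gS.
have -> : x = (\prod_(g <- s) g)%g by rewrite sx invg1 mul1g.
apply: WP => //.
rewrite -(ler_nat R) -ws; have /andP[_ h] := qi 1%g x; apply: le_trans h _.
have n0 : 0 <= n%:R :> R by [].
have : L * d 1%g x <= L * n%:R by rewrite ler_wpM2l//; lra.
have : (L + C) * n.+1%:R <= c%:R * n.+1%:R by rewrite ler_wpM2r// ltW.
by rewrite natrM -natr1; have := mulr_ge0 C0 n0; lra.
Qed.

(** The upper bound on balls matters as well, since [fine] sends an infinite upper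
    limit to 0. *)
Lemma growth_rate_gt0 : ~ virtually_cyclic G -> 0 < growth_rate d.
Proof.
move=> nvc; have [c [c0 grow]] := exponential_growth nvc.
have [b b0 ballb] := ball_card_le.
pose N n := #|` fset_set [set x | d 1%g x < n%:R]|.
pose u (n : nat) : \bar R := (ln (N n)%:R / n%:R)%:E.
have N0 n : (0 < n)%N -> (0 < N n)%N.
  move=> n0; rewrite cardfs_gt0; apply/fset0Pn; exists 1%g.
  by rewrite in_fset_set ?inE /= ?hyp_xx ?ltr0n//; exact: hyp_ball_finite.
have lnb : 0 <= ln b%:R :> R by rewrite ln_ge0// ler1n.
have uub n : (u n <= (2 * ln b%:R)%:E)%E.
  rewrite lee_fin; have [->|n0] := eqVneq n 0%N.
    by rewrite invr0 mulr0; lra.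
  rewrite -lt0n in n0; rewrite ler_pdivrMr ?ltr0n//.
  apply: (@le_trans _ _ (ln (b ^ n.+1)%:R)).
    by rewrite ler_ln ?posrE ?ltr0n ?N0 ?expn_gt0 ?b0// ler_nat ballb.
  have n1 : 1 <= n%:R :> R by rewrite ler1n.
  rewrite natrX lnXn ?ltr0n// mulrSr -[ln _ *+ n]mulr_natr.
  by have := ler_wpM2l lnb n1; lra.
pose h : R := ln 2 / c.+1%:R.
have h0 : 0 < h by rewrite divr_gt0// ln_gt0//; lra.
have ulb m : exists2 n, (m <= n)%N & (h%:E <= u n)%E.
  pose k := m.+1; have [l [luniq lk lP]] := grow k.
  exists (c * k).+1; first by rewrite /k; nia.
  rewrite lee_fin ler_pdivlMr// mulrAC ler_pdivrMr//.
  have kN : (2 ^ k <= N (c * k).+1)%N.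
    apply: leq_trans lk _; apply: uniq_leq_size => // z zl.
    rewrite in_fset_set ?inE /=; last exact: hyp_ball_finite.
    by apply: le_lt_trans (lP z zl) _; rewrite ltr_nat.
  apply: (@le_trans _ _ (ln (2 ^ k)%:R * c.+1%:R)); last first.
    by rewrite ler_wpM2r// ler_ln ?posrE ?ltr0n ?N0 ?expn_gt0// ler_nat.
  rewrite natrX lnXn// -[ln _ *+ k]mulr_natr -mulrA ler_wpM2l//; first by rewrite ln_ge0//; lra.
  by rewrite -natrM ler_nat /k; nia.
have le1 : (h%:E <= limn_esup u)%E.
  rewrite limn_esup_lim; apply: lime_ge; first exact: is_cvg_esups.
  apply: nearW => m; have [n mn hn] := ulb m.
  by apply: le_trans hn _; apply: ereal_sup_ubound; exists n.
have le2 : (limn_esup u <= (2 * ln b%:R)%:E)%E.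
  rewrite limn_esup_lim; apply: lime_le; first exact: is_cvg_esups.
  apply: nearW => m; apply: ge_ereal_sup => _ [n _ <-]; exact: uub.
rewrite /growth_rate -/u; case: (limn_esup u) le1 le2 => //= t.
by rewrite !lee_fin; lra.
Qed.

End Growth.

(** * Hyperbolic metrics close to a linear combination *)

Section Combination.
Variables (R : realType) (G : groupType) (d e : hypMetric R G).
Implicit Types (x y z w p q : G).
Local Notation gp := (@gromov_product R G).

Lemma lin_bound (a b u v B : R) : `|u| <= B -> `|v| <= B ->
  `|a * u + b * v| <= (`|a| + `|b|) * B.
Proof.
move=> uB vB; apply: le_trans (ler_normD _ _) _.
by rewrite !normrM mulrDl lerD// ler_wpM2l.
Qed.

Lemma gp_center (f : hypMetric R G) (A : R) x y z p :
  gp f p x y <= A -> gp f p y z <= A -> gp f p x z <= A ->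
  `|gp f z x y - f z p| <= 2 * A.
Proof.
move=> h1 h2 h3; have := gp_ge0 f p x y; have := gp_ge0 f p y z.
have := gp_ge0 f p x z; move: h1 h2 h3; rewrite !gpE.
rewrite (hyp_sym f z p) (hyp_sym f z x) (hyp_sym f z y) => *.
by rewrite ler_norml; apply/andP; split; lra.
Qed.

(** The function a d + b e is bounded below by [norm_stable_length], since this
    holds for the length functions. Its Gromov products are its values at common
    branching points ([common_center]), hence are bounded below as well: adding a
    large constant off the diagonal restores the triangle inequality. *)
Lemma combination (a b c : R) : ~ virtually_cyclic G -> 0 < c ->
  (forall x, c * stable_length d x <= a * stable_length d x + b * stable_length e x) ->
  exists psi : hypMetric R G, exists C : R,
    forall x y, `|psi x y - (a * d x y + b * e x y)| <= C.
Proof.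
move=> nvc c0 abc.
pose ps x y : R := a * d x y + b * e x y.
pose gps z x y : R := a * gp d z x y + b * gp e z x y.
pose ab := `|a| + `|b|; have ab0 : 0 <= ab by rewrite addr_ge0.
have gpsC z x y : gps z x y = gps z y x by rewrite /gps !(gpC _ z x y).
have gpsE z x y : ps z x + ps z y - ps x y = 2 * gps z x y.
  by rewrite /ps /gps !gpE; lra.
have [C1 [C10 low]] : exists C1 : R, 0 <= C1 /\ forall x y, c * d x y - C1 <= ps x y.
  have [C [C0 nl]] := norm_stable_length d e nvc.
  exists (ab * C + c * C); split.
    by rewrite addr_ge0// mulr_ge0// ltW.
  move=> x y; have [t [t1 t2]] := nl (x^-1 * y)%g.
  have dE (f : hypMetric R G) : f x y = f 1%g (x^-1 * y)%g.
    by rewrite -(hyp_inv f x^-1%g) mulVg.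
  rewrite /ps !dE; have := lin_bound a b t1 t2; have := abc t.
  have : c * d 1%g (x^-1 * y)%g <= c * (stable_length d t + C).
    by rewrite ler_pM2l//; move: t1; rewrite ler_norml => /andP[]; lra.
  by rewrite -/ab ler_norml => ? ? /andP[]; lra.
have low0 x y : - C1 <= ps x y.
  by apply: le_trans (low x y); have := mulr_ge0 (ltW c0) (hyp_ge0 d x y); lra.
have [A A0 cen] := common_center d e.
have cps z x y p : [/\ gp d p x y <= A, gp d p y z <= A & gp d p x z <= A] ->
    [/\ gp e p x y <= A, gp e p y z <= A & gp e p x z <= A] ->
    `|gps z x y - ps z p| <= ab * (2 * A).
  move=> [d1 d2 d3] [e1 e2 e3].
  have := lin_bound a b (gp_center d1 d2 d3) (gp_center e1 e2 e3).
  by rewrite -/ab; congr (`|_| <= _); rewrite /gps /ps; lra.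
have abA : 0 <= ab * (2 * A) by rewrite mulr_ge0//; lra.
have gps_ge z x y : - (C1 + ab * (2 * A)) <= gps z x y.
  have [p [pd pe]] := cen x y z; have := cps z x y p pd pe; have := low0 z p.
  by rewrite ler_norml => ? /andP[]; lra.
have [dl hd] := hyp_constP d; have [dl0 hyp] := hd.
have [A' hA'] := morse d e (6 * A + 2 * dl).
pose C3 := C1 + ab * (2 * (6 * A + 2 * dl + `|A'|)) + 2 * (ab * (2 * A)).
(* The branching point P closest to z lies on the geodesic from z to the
   branching point T of x and y, so that it costs at most a constant in gps. *)
have half x y z w P Q :
    [/\ gp d P x w <= A, gp d P w z <= A & gp d P x z <= A] ->
    [/\ gp e P x w <= A, gp e P w z <= A & gp e P x z <= A] ->
    `|gp d z w y - d z Q| <= 2 * A -> d z P <= d z Q ->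
    gps z x w - C3 <= gps z x y.
  move=> Pd Pe zQ zPQ; have [T [Td Te]] := cen x y z.
  have cP := cps z x w P Pd Pe; have cT := cps z x y T Td Te.
  have PT : gp d P z T <= 6 * A + 2 * dl.
    have [d1 d2 d3] := Pd; have [t1 t2 t3] := Td.
    have := gp_center d1 d2 d3; have := gp_center t1 t2 t3.
    move: zQ; rewrite !ler_norml => /andP[q1 q2] /andP[u1 u2] /andP[v1 v2].
    have zT : d z P - 4 * A - dl <= d z T by case: (hyp x y z w); lra.
    have := level_dist z x P T hd.
    have := gp_ge0 d P z x; have := gp_ge0 d T z x.
    have := gp_split d z x P; have := gp_split d z x T.
    rewrite (gpC d P x z) in d3; rewrite (gpC d T x z) in t3.
    rewrite (gpE d P z T) (hyp_sym d P z) => s1 s2 s3 s4 s5.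
    move: s5; have [h|h] := leP 0 (gp d z P x - gp d z T x).
      by rewrite ger0_norm//; lra.
    by rewrite ltr0_norm//; lra.
  have PTe := hA' _ _ _ PT.
  have gPT : gps P z T <= ab * (6 * A + 2 * dl + `|A'|).
    have n0 := normr_ge0 A'; have n1 := ler_norm A'.
    have := gp_ge0 d P z T; have := gp_ge0 e P z T => e0 d0.
    apply: le_trans (ler_norm _) _; apply: lin_bound.
      by rewrite ger0_norm//; lra.
    by rewrite ger0_norm//; lra.
  have := gpsE P z T; have := low0 P T.
  have : ps P z = ps z P by rewrite /ps !(hyp_sym _ P z).
  by move: cP cT; rewrite !ler_norml /C3 => /andP[? ?] /andP[? ?]; lra.
have gps_hyp x y z w : gps z x w - C3 <= gps z x y \/ gps z w y - C3 <= gps z x y.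
  have [P [Pd Pe]] := cen x w z; have [Q [Qd Qe]] := cen w y z.
  have [d1 d2 d3] := Pd; have [q1 q2 q3] := Qd; have [e1 e2 e3] := Qe.
  have [PQ|/ltW QP] := leP (d z P) (d z Q).
    by left; apply: (half _ _ _ _ P Q Pd Pe) => //; exact: gp_center.
  right; rewrite (gpsC z w y) (gpsC z x y); apply: (half _ _ _ _ Q P) => //.
  - by split => //; rewrite gpC.
  - by split => //; rewrite gpC.
  - by rewrite (gpC d z w x); exact: gp_center.
pose D := C1 + 2 * (C1 + ab * (2 * A)); have D0 : 0 <= D by rewrite /D; lra.
pose f x y : R := if x == y then 0 else ps x y + D.
have psxx x : ps x x = 0 by rewrite /ps !hyp_xx; lra.
have fps x y : `|f x y - ps x y| <= D.
  rewrite /f; case: eqP => [->|_]; first by rewrite psxx subrr normr0.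
  by rewrite addrAC subrr add0r ger0_norm.
have pssym x y : ps x y = ps y x by rewrite /ps !(hyp_sym _ x y).
have f0 x y : 0 <= f x y.
  by rewrite /f; case: eqP => // _; have := low0 x y; rewrite /D; lra.
have fpm : pseudo_metric f.
  split => //.
  - by move=> x; rewrite /f eqxx.
  - by move=> x y; rewrite /f eq_sym pssym.
  - move=> x y z; have [<-|xy] := eqVneq x y; first by rewrite {2}/f eqxx add0r.
    have [<-|yz] := eqVneq y z; first by rewrite lerDl.
    have [<-|xz] := eqVneq x z; first by rewrite {1}/f eqxx addr_ge0.
    rewrite /f (negPf xy) (negPf yz) (negPf xz).
    have := gpsE y x z; have := gps_ge y x z; rewrite (pssym y x) /D; lra.
have finv : left_invariant f.
  by move=> g x y; rewrite /f (inj_eq (@mulgI _ g)) /ps !hyp_inv.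
have fgp z x y : `|gromov_product f z x y - gps z x y| <= 2 * D.
  have := gpsE z x y; have := fps x z; have := fps z y; have := fps x y.
  rewrite (pssym z x) /gromov_product !ler_norml.
  by move=> /andP[? ?] /andP[? ?] /andP[? ?] ?; apply/andP; split; lra.
have fhyp : gromov_hyperbolic f.
  exists (`|C3| + 4 * D) => [|x y z w]; first by rewrite addr_ge0//; lra.
  have := fgp z x y; have := fgp z x w; have := fgp z w y; have := ler_norm C3.
  rewrite !ler_norml => ? /andP[? ?] /andP[? ?] /andP[? ?].
  rewrite minEle; case: ifP => [?|/negbT]; last rewrite -ltNge => ?.
    by case: (gps_hyp x y z w); lra.
  by case: (gps_hyp x y z w); lra.
have [K K0 [Ce ed]] := hyp_le_affine e d.
have Ce0 : 0 <= Ce by have := ed 1%g 1%g; rewrite !hyp_xx; lra.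
have fword : exists2 S, finite_symmetric_generating S &
    quasi_isometric f (word_metric R S).
  have [S gS [L [C [L1 C0 qi _]]]] := hdist_word d; exists S => //.
  pose K1 := ab * (1 + K); pose B1 := ab * Ce + D.
  have K10 : 0 <= K1 by rewrite mulr_ge0//; lra.
  have B10 : 0 <= B1 by rewrite addr_ge0// mulr_ge0.
  have fle x y : f x y <= K1 * d x y + B1.
    have := fps x y; have d0 := hyp_ge0 d x y; have e0 := hyp_ge0 e x y.
    have exy : `|e x y| <= (1 + K) * d x y + Ce.
      by rewrite ger0_norm//; have := ed x y; lra.
    have dxy : `|d x y| <= (1 + K) * d x y + Ce.
      by rewrite ger0_norm//; have := mulr_ge0 K0 d0; lra.
    have := lin_bound a b dxy exy; rewrite -/ab -/(ps x y) !ler_norml.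
    by rewrite /K1 /B1 => /andP[? ?] /andP[? ?]; lra.
  have fge x y : d x y <= c^-1 * (f x y + C1 + D).
    rewrite mulrC ler_pdivlMr//; have := low x y; have := fps x y.
    by rewrite ler_norml => /andP[]; lra.
  have cV : 0 <= c^-1 by rewrite invr_ge0 ltW.
  pose L' := L * c^-1 + K1 * L + 1.
  pose C' := L * c^-1 * (C1 + D) + C + B1.
  have Lc : 0 <= L * c^-1 by rewrite mulr_ge0//; lra.
  have LK : 0 <= K1 * L by rewrite mulr_ge0//; lra.
  have LcD : 0 <= L * c^-1 * (C1 + D) by rewrite mulr_ge0//; lra.
  have L'1 : 1 <= L' by rewrite /L'; lra.
  have BC : B1 <= C' - C by rewrite /C'; lra.
  exists L', C'; split => //; first by rewrite /C'; lra.
    move=> x y; have /andP[w1 w2] := qi x y; rewrite /=; apply/andP; split.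
      have d0 := hyp_ge0 d x y; have L0 : 0 < L by lra.
      have w3 : d x y <= L * (word_metric R S x y + C).
        by rewrite -ler_pdivrMl//; lra.
      have w4 : 0 <= word_metric R S x y + C.
        by have : 0 <= L^-1 * d x y; [rewrite mulr_ge0// invr_ge0 ltW|lra].
      rewrite lerBlDr ler_pdivrMl; last lra.
      have h1 := fle x y; have h2 := ler_wpM2l K10 w3.
      have h3 := mulr_ge0 Lc w4; have h4 : B1 <= L' * (C' - C).
        by apply: (le_trans BC); rewrite ler_peMl//; exact: le_trans B10 BC.
      apply: (@le_trans _ _ (L' * (word_metric R S x y + C) + L' * (C' - C))); last lra.
      by rewrite {1}/L'; lra.
    have := ler_wpM2l (le_trans ler01 L1) (fge x y).
    have := mulr_ge0 LK (f0 x y); have := f0 x y; rewrite /L' /C'; lra.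
  move=> y; exists y; have /andP[_] := qi y y; rewrite hyp_xx mulr0 add0r /=.
  by rewrite /C'; lra.
by exists (HypMetric fpm finv fhyp fword), D.
Qed.

Lemma stable_length_combination (psi : hypMetric R G) (a b C : R) :
  (forall x y, `|psi x y - (a * d x y + b * e x y)| <= C) ->
  forall x, stable_length psi x = a * stable_length d x + b * stable_length e x.
Proof.
move=> near x.
have cn (B : R) : B / n%:R @[n --> \oo] --> (0 : R).
  rewrite -(mulr0 B); apply: cvgM; first exact: cvg_cst.
  apply/gtr0_cvgV0; last exact/cvgrnyP/cvg_id.
  by near=> n; rewrite ltr0n; near: n; exists 1%N.
pose v (n : nat) : R := psi 1%g (x ^+ n)%g / n%:R -
  (a * (d 1%g (x ^+ n)%g / n%:R) + b * (e 1%g (x ^+ n)%g / n%:R)).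
have v0 : v n @[n --> \oo] --> (0 : R).
  apply: (squeeze_cvgr _ (cn (- C)) (cn C)); apply: nearW => n.
  have -> : v n = (psi 1%g (x ^+ n)%g - (a * d 1%g (x ^+ n)%g + b * e 1%g (x ^+ n)%g))
      / n%:R by rewrite /v; lra.
  have := near 1%g (x ^+ n)%g; rewrite ler_norml => /andP[h1 h2].
  by apply/andP; split; rewrite ler_wpM2r// invr_ge0.
have vl : v n @[n --> \oo] --> stable_length psi x -
    (a * stable_length d x + b * stable_length e x).
  apply: cvgB; first exact: stable_length_cvg.
  by apply: cvgD; (apply: cvgM; [exact: cvg_cst|exact: stable_length_cvg]).
by apply/eqP; rewrite -subr_eq0; apply/eqP; apply: cvg_unique vl v0.
Unshelve. all: by end_near.
Qed.

End Combination.

(** * The bi-infinite geodesic through two metrics *)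

Section Geodesic.
Variables (R : realType) (G : groupType) (d e : hypMetric R G).
Hypothesis nvc : ~ virtually_cyclic G.
Hypothesis nrs : ~ roughly_similar d e.
Implicit Types (x y z : G) (s t : R).

Let m := (Dil d e)^-1.
Let M := Dil e d.

Lemma stable_length_Dil_all (f g : hypMetric R G) x :
  stable_length f x <= Dil f g * stable_length g x.
Proof.
have [g0|g0] := eqVneq (stable_length g x) 0.
  by rewrite g0 mulr0 (stable_length_eq0 f g0).
apply: stable_length_Dil; apply: (@stable_length_gt0_non_torsion _ _ g).
by rewrite lt_neqAle eq_sym g0 stable_length_ge0.
Qed.

Lemma Dil_gt0 (f g : hypMetric R G) : 0 < Dil f g.
Proof.
have [x x0] := stable_length_gt0_exists f nvc.
rewrite lt_neqAle Dil_ge0 andbT eq_sym; apply/eqP => fg0.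
by have := stable_length_Dil_all f g x; rewrite fg0 mul0r; lra.
Qed.

Let m_gt0 : 0 < m. Proof. by rewrite invr_gt0 Dil_gt0. Qed.

Lemma stable_length_bounds x :
  m * stable_length d x <= stable_length e x <= M * stable_length d x.
Proof.
rewrite stable_length_Dil_all andbT ler_pdivrMl ?Dil_gt0//.
exact: stable_length_Dil_all.
Qed.

(** Proportional stable lengths force rough similarity by [norm_stable_length]. *)
Lemma extremal_ratios_lt : m < M.
Proof.
rewrite ltNge; apply/negP => Mm; apply: nrs.
have prop x : stable_length e x = m * stable_length d x.
  have /andP[h1 h2] := stable_length_bounds x.
  by have := ler_wpM2r (stable_length_ge0 d x) Mm; lra.
have [C [C0 nl]] := norm_stable_length d e nvc.
have mC : 0 <= m * C by rewrite mulr_ge0// ltW.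
exists m, (m * C + C + 1); split; [exact: m_gt0|lra|move=> x y].
have dE (f : hypMetric R G) : f x y = f 1%g (x^-1 * y)%g.
  by rewrite -(hyp_inv f x^-1%g) mulVg.
have [t []] := nl (x^-1 * y)%g; rewrite !dE prop !ler_norml.
move=> /andP[h1 h2] /andP[h3 h4].
have h5 := ler_wpM2l (ltW m_gt0) h1; have h6 := ler_wpM2l (ltW m_gt0) h2.
by apply/andP; split; lra.
Qed.

Let mM : 0 < M - m. Proof. by rewrite subr_gt0 extremal_ratios_lt. Qed.

(** Up to the factor M - m, U and V are the extremal rays of the cone of the
    nonnegative combinations of the two length functions: d corresponds to
    V + U and e to m V + M U. *)
Let U x := stable_length e x - m * stable_length d x.
Let V x := M * stable_length d x - stable_length e x.

Let U_ge0 x : 0 <= U x.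
Proof. by have /andP[h1 h2] := stable_length_bounds x; rewrite /U; lra. Qed.

Let V_ge0 x : 0 <= V x.
Proof. by have /andP[h1 h2] := stable_length_bounds x; rewrite /V; lra. Qed.

(** Such an inequality would bound l' / l from below by a constant larger than its
    infimum m. *)
Lemma V_not_dominated k : ~ (forall x, non_torsion x -> V x <= k * U x).
Proof.
move=> VU; have k0 := normr_ge0 k; have kl := ler_norm k.
have m0 := m_gt0; have mM0 := mM.
have km0 := mulr_ge0 k0 (ltW m_gt0).
have MkM : 0 < M + `|k| * m by lra.
have : Dil d e <= (1 + `|k|) / (M + `|k| * m).
  apply: Dil_le => [|x ntx]; first by apply: divr_ge0; lra.
  rewrite mulrAC ler_pdivlMr//.
  have := VU x ntx; have := ler_wpM2r (U_ge0 x) kl; rewrite /V /U; lra.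
rewrite ler_pdivlMr// -[Dil d e]invrK -/m mulrC ler_pdivrMr//; lra.
Qed.

(** Such an inequality would bound l' / l from above by a constant smaller than its
    supremum M. *)
Lemma U_not_dominated k : ~ (forall x, non_torsion x -> U x <= k * V x).
Proof.
move=> UV; have k0 := normr_ge0 k; have kl := ler_norm k.
have m0 := m_gt0; have mM0 := mM.
have kM0 : 0 <= `|k| * M by rewrite mulr_ge0//; lra.
have : Dil e d <= (`|k| * M + m) / (1 + `|k|).
  apply: Dil_le => [|x ntx]; first by apply: divr_ge0; lra.
  rewrite mulrAC ler_pdivlMr; last lra.
  have := UV x ntx; have := ler_wpM2r (V_ge0 x) kl; rewrite /V /U; lra.
rewrite -/M ler_pdivlMr; lra.
Qed.

Let coef t := (expR t - 1) / (M - m).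

Let coefE t : coef t * (M - m) = expR t - 1.
Proof. by rewrite /coef divfK// gt_eqF// mM. Qed.

(** For a = 1 - coef t * m and b = coef t one has a + b m = 1 and
    a + b M = exp(t), so that the length function is proportional to
    V + exp(t) U. *)
Definition near_family t (psi : hypMetric R G) := exists C : R, forall x y,
  `|psi x y - ((1 - coef t * m) * d x y + coef t * e x y)| <= C.

Lemma near_family_length t psi : near_family t psi -> forall x,
  (M - m) * stable_length psi x = V x + expR t * U x.
Proof.
move=> [C hC] x; rewrite (stable_length_combination hC).
have -> : expR t = coef t * (M - m) + 1 by rewrite coefE; lra.
by rewrite /V /U; lra.
Qed.

Lemma near_family_exists t : exists psi, near_family t psi.
Proof.
have et := expR_gt0 t; have mM0 := mM.
apply: (@combination _ _ _ _ _ _ (Num.min 1 (expR t))) => //.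
  by rewrite lt_min ltr01.
move=> x; have l0 := stable_length_ge0 d x; have u0 := U_ge0 x; have v0 := V_ge0 x.
rewrite -(ler_pM2l mM0).
apply: (@le_trans _ _ (V x + expR t * U x)); last first.
  have -> : expR t = coef t * (M - m) + 1 by rewrite coefE; lra.
  by rewrite /V /U; lra.
have -> : (M - m) * (Num.min 1 (expR t) * stable_length d x)
  = Num.min 1 (expR t) * V x + Num.min 1 (expR t) * U x by rewrite /V /U; lra.
apply: lerD; last by rewrite ler_wpM2r// ge_min lexx orbT.
by rewrite -[leRHS]mul1r ler_wpM2r// ge_min lexx.
Qed.

(** The ratio (V + exp(s) U) / (V + exp(t) U) is at most 1, and it is close to 1
    where U is small compared to V. *)
Lemma near_family_Dil_up s t psi phi : s <= t ->
  near_family s psi -> near_family t phi -> Dil psi phi = 1.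
Proof.
move=> st hs ht; have Ls := near_family_length hs; have Lt := near_family_length ht.
have mM0 := mM; apply/eqP; rewrite eq_le; apply/andP; split.
  apply: Dil_le => // x _; rewrite mul1r -(ler_pM2l mM0) Ls Lt lerD2l.
  by rewrite ler_wpM2r// ler_expR.
rewrite leNgt; apply/negP => B1.
apply: (@V_not_dominated ((Dil psi phi * expR t - expR s) / (1 - Dil psi phi))).
move=> x _; rewrite mulrAC ler_pdivlMr; last lra.
have := stable_length_Dil_all psi phi x; rewrite -(ler_pM2l mM0) Ls mulrCA Lt.
lra.
Qed.

(** Dually, the inverse ratio is at most exp(t - s), and it is close to this where
    V is small compared to U. *)
Lemma near_family_Dil_down s t psi phi : s <= t ->
  near_family s psi -> near_family t phi -> Dil phi psi = expR (t - s).
Proof.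
move=> st hs ht; have Ls := near_family_length hs; have Lt := near_family_length ht.
have mM0 := mM; have es := expR_gt0 s.
have E : expR (t - s) * expR s = expR t by rewrite -expRD subrK.
have E1 : 1 <= expR (t - s) by rewrite -expR0 ler_expR subr_ge0.
apply/eqP; rewrite eq_le; apply/andP; split.
  apply: Dil_le => [|x _]; first exact: expR_ge0.
  rewrite -(ler_pM2l mM0) mulrCA Ls Lt -E.
  by have := ler_wpM2r (V_ge0 x) E1; lra.
rewrite leNgt; apply/negP => B1.
have B2 : 0 < expR t - Dil phi psi * expR s.
  by rewrite subr_gt0 -E ltr_pM2r.
apply: (@U_not_dominated ((Dil phi psi - 1) / (expR t - Dil phi psi * expR s))).
move=> x _; rewrite mulrAC ler_pdivlMr//.
have := stable_length_Dil_all phi psi x; rewrite -(ler_pM2l mM0) Lt mulrCA Ls.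
lra.
Qed.

Lemma near_family_Delta s t psi phi :
  near_family s psi -> near_family t phi -> hyp_Delta psi phi = `|t - s|.
Proof.
move=> hs ht; have [st|/ltW ts] := leP s t.
  rewrite /hyp_Delta (near_family_Dil_up st hs ht) (near_family_Dil_down st hs ht).
  by rewrite mul1r expRK ger0_norm// subr_ge0.
rewrite /hyp_Delta (near_family_Dil_up ts ht hs) (near_family_Dil_down ts ht hs).
by rewrite mulr1 expRK distrC ger0_norm// subr_ge0.
Qed.

Lemma near_family_start psi : near_family 0 psi -> roughly_similar psi d.
Proof.
move=> [C hC]; exists 1, (`|C| + 1); split => [//||x y]; first by rewrite ltr_wpDl.
have := hC x y; have -> : coef 0 = 0 by rewrite /coef expR0 subrr mul0r.
rewrite !mul0r subr0 addr0 !mul1r => /le_trans; apply.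
by have := ler_norm C; lra.
Qed.

Lemma near_family_end psi : near_family (ln (M / m)) psi -> roughly_similar psi e.
Proof.
have m0 := m_gt0; have mM0 := mM.
move=> [C hC]; exists m, (m * `|C| + 1); split => [//||x y].
  by rewrite ltr_wpDl// mulr_ge0// ltW.
have := hC x y; have -> : coef (ln (M / m)) = m^-1.
  rewrite /coef lnK; last by rewrite posrE divr_gt0//; lra.
  have -> : M / m - 1 = m^-1 * (M - m) by rewrite mulrBr mulVf ?gt_eqF// mulrC.
  by rewrite mulfK// gt_eqF.
rewrite mulVf ?gt_eqF// subrr mul0r add0r => h.
have -> : m * psi x y - e x y = m * (psi x y - m^-1 * e x y).
  by rewrite mulrBr mulVKf// gt_eqF.
rewrite normrM gtr0_norm//; have := ler_wpM2l (ltW m0) (le_trans h (ler_norm C)).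
lra.
Qed.

Lemma end_gt0 : 0 < ln (M / m).
Proof. by rewrite ln_gt0// ltr_pdivlMr ?m_gt0// mul1r; have := mM; lra. Qed.

Lemma geodesic_line : exists (T : R) (sigma : R -> metricStruct R G),
  [/\ 0 < T, sigma 0 = struct_class d, sigma T = struct_class e &
    forall s t, Delta (sigma s) (sigma t) = `|t - s|].
Proof.
have /choice[psi psiP] := near_family_exists.
exists (ln (M / m)), (fun t => struct_class (psi t)); split.
- exact: end_gt0.
- by apply/struct_classP; apply: near_family_start.
- by apply/struct_classP; apply: near_family_end.
- by move=> s t; rewrite DeltaE (near_family_Delta (psiP s) (psiP t)).
Qed.

End Geodesic.

Theorem theorem1p2 (R : realType) (Gamma : groupType)
    (hyp_Gamma : hyperbolic_group R Gamma)
    (nonelem_Gamma : ~ virtually_cyclic Gamma)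
    (d dstar : hypMetric R Gamma)
    (d_neq_dstar : struct_class d <> struct_class dstar) :
  exists rho : R -> metricStruct R Gamma,
    [/\ continuous rho,
        injective rho,
        rho 0 = struct_class d /\ rho (growth_rate dstar) = struct_class dstar,
        forall r s t : R, r < s -> s < t ->
          Delta (rho r) (rho t) = Delta (rho r) (rho s) + Delta (rho s) (rho t) &
        Delta (rho t) (rho (growth_rate dstar)) @[t --> +oo] --> +oo /\
        Delta (rho t) (rho 0) @[t --> -oo] --> +oo].
Proof.
have [|T [sigma [T0 sigma0 sigmaT sigmaD]]] := @geodesic_line R Gamma d dstar nonelem_Gamma.
  by move=> /struct_classP.
have h0 : 0 < growth_rate dstar by exact: growth_rate_gt0.
set h := growth_rate dstar in h0 *; pose k := T / h.
have k0 : 0 < k by rewrite divr_gt0.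
pose rho t := sigma (k * t).
have rhoD s t : Delta (rho s) (rho t) = k * `|t - s|.
  by rewrite sigmaD -mulrBr normrM gtr0_norm.
exists rho; split.
- move=> t; apply/cvg_ballP => eps eps0; near=> s.
  rewrite ball_Delta /= rhoD mulrC -ltr_pdivlMr//.
  rewrite distrC; near: s; apply: cvgr_dist_lt => //.
  by rewrite divr_gt0.
- move=> s t st; have := rhoD s t; rewrite st rhoD subrr normr0 mulr0.
  move/esym/eqP; rewrite mulf_eq0 gt_eqF//= normr_eq0 subr_eq0.
  by move=> /eqP ->.
- by rewrite /rho mulr0 /k divfK ?gt_eqF.
- move=> r s t rs st; rewrite !rhoD -mulrDr; congr (_ * _).
  by rewrite !gtr0_norm; lra.
- split; apply/cvgryPge => A; near=> t; rewrite rhoD mulrC -ler_pdivrMr//.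
    have th : h + A / k <= t.
      by near: t; apply: nbhs_pinfty_ge; exact: num_real.
    by rewrite distrC; apply: le_trans (ler_norm _); lra.
  have th : t <= - (A / k) by near: t; apply: nbhs_ninfty_le; exact: num_real.
  by rewrite sub0r; apply: le_trans (ler_norm _); lra.
Unshelve. all: by end_near.
Qed.
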